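(* Let $K=\mathbb{Q}(\sqrt{d})$, with $d<0$ a square-free integer, be an imaginary quadratic field with ring of integers $\mathcal{O}$, and let $V\subset\mathcal{O}$ be the set of square-free elements. Then every $A\in\mathrm{stab}(V)$ is of the form $A=m_{\varepsilon}\circ\sigma$ for some $\varepsilon\in\mathcal{O}^{\times}$ and some $\sigma\in\mathrm{Gal}(K/\mathbb{Q})\simeq C_2$. Every such mapping is bijective on $V$, and the stabiliser of $V$ is a group, $$\mathrm{stab}(V)=\mathcal{O}^{\times}\rtimes\mathrm{Gal}(K/\mathbb{Q})\simeq C_n\rtimes C_2=D_n,$$ where $D_n$ is the dihedral group of order $2n$, with $n=4$ for $d=-1$, $n=6$ for $d=-3$, and $n=2$ in all remaining cases.
   Context: An element $0\neq x\in\mathcal{O}$ is square-free if $v_{\mathfrak{p}}(x)<2$ for all prime ideals $\mathfrak{p}$ of $\mathcal{O}$, where $v_{\mathfrak{p}}(x)$ is the exponent of $\mathfrak{p}$ in the prime ideal factorisation of the principal ideal $(x)$. The stabiliser $\mathrm{stab}(V)$ is the set (a monoid under composition) of all $\mathbb{Z}$-linear bijections $A$ of $\mathcal{O}$ with $A(V)\subseteq V$. For $\varepsilon\in\mathcal{O}^{\times}$, $m_{\varepsilon}$ denotes the map $x\mapsto\varepsilon x$ on $\mathcal{O}$; the group $\mathcal{O}^{\times}$ is identified with the group of these maps, and $\mathrm{Gal}(K/\mathbb{Q})$ acts on $\mathcal{O}^\times$ in the natural way, $\sigma\circ m_\varepsilon\circ\sigma^{-1}=m_{\sigma(\varepsilon)}$.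 $C_n$ is the cyclic group of order $n$ and $D_n=C_n\rtimes C_2$ (so $D_2\simeq C_2\times C_2$). *)

(* Defs.v *)
From HB Require Import structures.
From mathcomp Require Import all_boot all_order all_algebra.
From mathcomp Require Import all_fingroup all_solvable all_field.
From mathcomp Require Import ring_quotient.
From mathcomp Require Import mathcomp_extra boolp classical_sets functions.

Set Implicit Arguments.
Unset Strict Implicit.
Unset Printing Implicit Defensive.

Import GRing.Theory Num.Theory.

Local Open Scope ring_scope.
Local Open Scope classical_set_scope.

Definition squarefree_int (d : int) : Prop :=
  forall m : int, (m ^+ 2 %| d)%Z -> `|m|%N = 1%N.

Section RingOfIntegers.
Variable K : fieldExtType rat.

Definition is_integral : {pred K} := fun x => `[< integralOver (intr : int -> K) x >].

Fact is_integral_subring : subring_closed is_integral.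
Proof.
split=> [|x y /asboolP xI /asboolP yI|x y /asboolP xI /asboolP yI];
  apply/asboolP; [exact: integral1|exact: integral_sub|exact: integral_mul].
Qed.

HB.instance Definition _ := GRing.isSubringClosed.Build K is_integral
  is_integral_subring.

Record ringOfIntegers := RingOfIntegers {
  roi_val :> K;
  roi_valP : roi_val \in is_integral }.

HB.instance Definition _ := [isSub for roi_val].
HB.instance Definition _ := [Choice of ringOfIntegers by <:].
HB.instance Definition _ :=
  [SubChoice_isSubComNzRing of ringOfIntegers by <:].

Definition roi_unit : {pred ringOfIntegers} := fun x => `[< exists y, y * x = 1 >].
Definition roi_inv (x : ringOfIntegers) : ringOfIntegers :=
  xget x [set y | y * x = 1].

Fact roi_mulVx : {in roi_unit, left_inverse 1 roi_inv *%R}.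
Proof. by move=> x /asboolP[y yx]; rewrite /roi_inv; case: xgetP => [//|/(_ y)]. Qed.

Fact roi_unitPl (x y : ringOfIntegers) : y * x = 1 -> roi_unit x.
Proof. by move=> yx; apply/asboolP; exists y. Qed.

Fact roi_invr_out : {in [predC roi_unit], roi_inv =1 id}.
Proof.
move=> x; rewrite inE /= => /asboolPn xN; rewrite /roi_inv.
by case: xgetP => // y _ yx; case: xN; exists y.
Qed.

HB.instance Definition _ := GRing.ComNzRing_hasMulInverse.Build ringOfIntegers
  roi_mulVx roi_unitPl roi_invr_out.

End RingOfIntegers.

Section SquareFree.
Variable R : comNzRingType.

(* [idealr_closed] includes properness *)
Definition prime_ideal (P : set R) : Prop :=
  idealr_closed [in P] /\ prime_idealr_closed [in P].

Definition principal_ideal (x : R) : set R := [set a * x | a in setT].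

Definition ideal_mul (I J : set R) : set R :=
  [set x | exists n (a b : 'I_n -> R),
    [/\ forall i, I (a i), forall i, J (b i) & x = \sum_i a i * b i]].

Definition prime_factorisation (x : R) (s : seq (set R)) : Prop :=
  {in s, forall P, prime_ideal P} /\
  \big[ideal_mul/setT]_(P <- s) P = principal_ideal x.

(* In a Dedekind domain and for [x != 0] the factorisation exists and is unique
   up to order, so the value depends neither on the choice made by [xget] nor on
   its default [[::]]. *)
Definition ideal_valuation (P : set R) (x : R) : nat :=
  count_mem P (xget [::] [set s | prime_factorisation x s]).

Definition square_free : set R :=
  [set x | x != 0 /\
           forall P : set R, prime_ideal P -> (ideal_valuation P x < 2)%N].

End SquareFree.

Definition Zlinear (M : zmodType) (A : M -> M) : Prop :=
  forall (k : int) (x y : M), A (x *~ k + y) = A x *~ k + A y.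

Definition stab (M : zmodType) (V : set M) : set (M -> M) :=
  [set A | [/\ Zlinear A, bijective A & A @` V `<=` V]].

Section CompositionGroups.
Variable T : Type.
Implicit Types G N H : set (T -> T).

Definition comp_group G : Prop :=
  [/\ G id, forall A B, G A -> G B -> G (A \o B)
    & forall A, G A -> exists B, [/\ G B, cancel A B & cancel B A]].

(* G is the internal semidirect product of its normal subgroup N and its
   subgroup H. *)
Definition comp_sdprod N H G : Prop :=
  [/\ [/\ comp_group G, comp_group N & comp_group H],
      N `<=` G /\ H `<=` G,
      forall A B C, G A -> cancel A B -> cancel B A -> N C -> N (A \o C \o B),
      N `&` H = [set id]
    & G = [set A \o B | A in N & B in H]].

Definition comp_isog G (gT : finGroupType) : Prop :=
  exists2 f : gT -> T -> T,
    {morph f : x y / (x * y)%g >-> x \o y} & set_bij setT G f.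

End CompositionGroups.

Section GaloisAction.
Variable K : splittingFieldType rat.
Local Notation O := (ringOfIntegers K).

Definition unit_mul (eps : O) : O -> O := fun x => eps * x.

Fact gal_integral (sigma : gal_of {:K}) (x : O) :
  sigma (val x) \in @is_integral K.
Proof.
apply/asboolP; have /asboolP := valP x.
case=> p mon_p px0; exists p => //.
have -> : map_poly intr p = map_poly sigma (map_poly (intr : int -> K) p).
  by rewrite -map_poly_comp; apply: eq_map_poly => k /=; rewrite rmorph_int.
exact: rmorph_root.
Qed.

Definition gal_restr (sigma : gal_of {:K}) : O -> O :=
  fun x => RingOfIntegers (gal_integral sigma x).

Definition unit_maps : set (O -> O) :=
  [set unit_mul eps | eps in [set eps : O | eps \is a GRing.unit]].

Definition gal_maps : set (O -> O) :=
  [set gal_restr sigma | sigma in [set sigma | sigma \in ('Gal({:K} / 1))%g]].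

End GaloisAction.

(* The group 'Gal(_ / _) is only available over a [splittingFieldType]; this
   is no restriction for quadratic extensions. *)
Lemma quadratic_splitting (K : fieldExtType rat) (d : int) (s : K) :
  s ^+ 2 = d%:~R -> <<1; s>>%VS = fullv -> SplittingField.axiom K.
Proof.
move=> s2 sK; exists ('X^2 - (d%:~R)%:P).
  by rewrite rpredB ?rpredX ?polyOverX ?polyOverC ?rpred_int.
exists [:: s; - s].
  rewrite big_cons big_seq1 polyCN opprK -subr_sqr -s2 -rmorphXn.
  exact: eqpxx.
rewrite adjoin_cons sK; apply/eqP; rewrite eqEsubv subvf /=.
exact: subv_adjoin_seq.
Qed.

(* Main.v *)
(* Let N be the norm form. If A is in the stabiliser with inverse B, pick a large
   split prime p, say r ^ 2 = d modulo p ^ 2, so that q = (p, s - r) is a prime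
   ideal with s - r in q ^ 2. The lattice A^-1(q ^ 2) has no square-free element,
   as A would map it to a square-free element of q ^ 2. But a sieve in the two
   coordinates finds a square-free element in every lattice without local
   obstruction, so the obstruction at p must be present: p ^ 2 divides
   N(B(s - r)), and likewise N(B(s + r)). Since p is arbitrarily large, the
   binary quadratic form N(B(x)) is proportional to N; surjectivity makes the
   factor 1, so B is an isometry up to a unit, i.e. multiplication by the unit
   B(1) composed with the identity or the conjugation.

   The ideal theory needed to read off square-freeness rests on a single fact:
   I times its conjugate is generated by an integer, because a product x * y' of
   x in I with a conjugate y' of y in I has trace and norm divisible by the gcd
   of the norms and thus is itself divisible by it. *)
Require Import Defs.
From HB Require Import structures.
From mathcomp Require Import all_boot all_order all_algebra.
From mathcomp Require Import all_fingroup all_solvable all_field.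
From mathcomp Require Import ring lra zify.
From mathcomp Require Import mathcomp_extra boolp classical_sets functions.

Set Implicit Arguments.
Unset Strict Implicit.
Unset Printing Implicit Defensive.

Import Order.TTheory GRing.Theory Num.Theory.

Local Open Scope ring_scope.
Local Open Scope classical_set_scope.

(** * Ideals of a quadratic ring *)

(** The hypothesis on [A] is one-sided: nothing is assumed about elements outside [V]. So only
    obstructions can be pulled back, and all estimates concern the inverse [B]. A single split prime
    suffices, because [N (B (s - r))] is a quadratic polynomial in [r] whose coefficients are fixed
    before [p] is chosen: congruences modulo [p ^ 2] at [r] and at [- r] turn into equalities once
    [p] is large compared with them. The ring may be larger than Z[s], but the sieve runs in this
    suborder; a factor [2 * e] clears the denominators of coordinates. That the ring is the full
    ring of integers enters through the division property [qr_div]. *)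

Section Ideals.
Variable R : comNzRingType.
Implicit Types (I J P Q : set R) (x y z : R).

(** Properness is left out on purpose: the whole ring occurs as the empty product and as a colon
    ideal. *)
Definition is_ideal I := I 0 /\ forall a x y, I x -> I y -> I (a * x + y).

Lemma is_idealD I x y : is_ideal I -> I x -> I y -> I (x + y).
Proof. by case=> _ IM Ix Iy; rewrite -[x]mul1r; apply: IM. Qed.

Lemma is_idealM I a x : is_ideal I -> I x -> I (a * x).
Proof. by case=> I0 IM Ix; rewrite -[_ * _]addr0; apply: IM. Qed.

Lemma is_idealB I x y : is_ideal I -> I x -> I y -> I (x - y).
Proof.
by move=> iI Ix Iy; apply: is_idealD => //; rewrite -mulN1r; apply: is_idealM.
Qed.

Lemma ideal_mul_ind I J (Q : R -> Prop) :
    Q 0 -> (forall x y, Q x -> Q y -> Q (x + y)) ->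
    (forall x y, I x -> J y -> Q (x * y)) ->
  forall x, ideal_mul I J x -> Q x.
Proof.
move=> Q0 QD QM x [n [a [b [Ia Jb ->]]]].
by apply: big_ind => [||i _]; [exact: Q0|exact: QD|exact: QM].
Qed.

Lemma ideal_mul_sub I J I' J' :
  I `<=` I' -> J `<=` J' -> ideal_mul I J `<=` ideal_mul I' J'.
Proof.
move=> sI sJ x [n [a [b [Ia Jb ->]]]]; exists n, a, b.
by split=> // i; [apply: sI|apply: sJ].
Qed.

Lemma mem_ideal_mul I J x y : I x -> J y -> ideal_mul I J (x * y).
Proof.
by move=> Ix Jy; exists 1, (fun=> x), (fun=> y); split=> //; rewrite big_ord1.
Qed.

Lemma ideal_mul_ideal I J : is_ideal I -> is_ideal (ideal_mul I J).
Proof.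
move=> iI; split.
  by exists 0, (fun=> 0), (fun=> 0); split=> [[]|[]|] //; rewrite big_ord0.
move=> c _ _ [n [a [b [Ia Jb ->]]]] [m [a' [b' [Ia' Jb' ->]]]].
pose u i := match fintype.split i with inl j => c * a j | inr j => a' j end.
pose v i := match fintype.split i with inl j => b j | inr j => b' j end.
exists (n + m)%N, u, v; split=> [i|i|].
- by rewrite /u; case: fintype.split => j //; apply: is_idealM.
- by rewrite /v; case: fintype.split => j.
rewrite big_split_ord /= mulr_sumr; congr (_ + _); apply: eq_bigr => i _.
  by rewrite /u /v (unsplitK (inl i)) mulrA.
by rewrite /u /v (unsplitK (inr i)).
Qed.

Lemma ideal_mulC I J : ideal_mul I J = ideal_mul J I.
Proof.
by apply/seteqP; split=> x [n [a [b [Ia Jb ->]]]]; exists n, b, a;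
  split=> //; apply: eq_bigr => i _; rewrite mulrC.
Qed.

Lemma ideal_mul_subr I J : is_ideal J -> ideal_mul I J `<=` J.
Proof.
move=> iJ; apply: ideal_mul_ind => [||x y _ Jy]; first by case: iJ.
  by move=> x y; apply: is_idealD.
exact: is_idealM.
Qed.

Lemma ideal_mul_subl I J : is_ideal I -> ideal_mul I J `<=` I.
Proof. by rewrite ideal_mulC; apply: ideal_mul_subr. Qed.

Lemma ideal_mulT I : is_ideal I -> ideal_mul I setT = I.
Proof.
move=> iI; apply/seteqP; split; first exact: ideal_mul_subl.
by move=> x Ix; rewrite -[x]mulr1; apply: mem_ideal_mul.
Qed.

Lemma ideal_eqT I : is_ideal I -> I 1 -> I = setT.
Proof.
by move=> iI I1; apply/seteqP; split=> // x _; rewrite -[x]mulr1; apply: is_idealM.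
Qed.

Lemma principal_idealP x : is_ideal (principal_ideal x).
Proof.
split; first by exists 0; rewrite ?mul0r.
by move=> a _ _ [b _ <-] [c _ <-]; exists (a * b + c) => //; rewrite mulrDl mulrA.
Qed.

Lemma mem_principal_ideal x : principal_ideal x x.
Proof. by exists 1; rewrite ?mul1r. Qed.

Lemma prime_idealP P :
  prime_ideal P <->
    [/\ is_ideal P, ~ P 1 & forall x y, P (x * y) -> P x \/ P y].
Proof.
have mE (x : R) : (x \in [in P]) = (x \in P) by [].
split=> [[[P0 P1 PD] PM]|[[P0 PD] P1 PM]].
  split; first split; rewrite ?mE in P0 P1 *.
  - exact: set_mem.
  - by move=> a x y Px Py; apply: set_mem; apply: PD; rewrite !mE; apply: mem_set.
  - by move/mem_set=> H; rewrite H in P1.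
  move=> x y Pxy; have := PM x y; rewrite !mE => /(_ (mem_set Pxy)).
  by case/orP => /set_mem; [left|right].
split; first split; rewrite ?mE.
- exact: mem_set.
- by apply/negP => /set_mem.
- by move=> a x y /set_mem Px /set_mem Py; apply: mem_set; apply: PD.
by move=> x y /set_mem/PM[] Pz; apply/orP; [left|right]; apply: mem_set.
Qed.

End Ideals.

(* The arithmetic of a quadratic order that is closed under division by the
   integers: an element whose trace and norm are divisible by [g] and [g ^ 2]
   is a multiple of [g]. *)
Record quadratic_ring (R : comNzRingType) (cj : {rmorphism R -> R})
    (N T : R -> int) : Prop := QuadraticRing {
  qr_conjK : involutive cj;
  qr_intr_inj : injective (intr : int -> R);
  qr_normE : forall x, (N x)%:~R = x * cj x;
  qr_traceE : forall x, (T x)%:~R = x + cj x;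
  qr_norm_gt0 : forall x, x != 0 -> 0 < N x;
  qr_div : forall (g : int) x, g != 0 -> (g ^+ 2 %| N x)%Z -> (g %| T x)%Z ->
    exists y, x = g%:~R * y }.

(** * Invertibility of ideals, prime factorisation, and a criterion for square-freeness *)

Section QuadraticIdeals.
Variables (R : comNzRingType) (cj : {rmorphism R -> R}) (N T : R -> int).
Hypothesis qR : quadratic_ring cj N T.
Implicit Types (I J P Q : set R) (x y z : R) (g h : nat).

Let cjK := qr_conjK qR.
Let intr_inj := qr_intr_inj qR.
Let NE := qr_normE qR.
Let TE := qr_traceE qR.

Lemma qr_norm0 : N 0 = 0.
Proof. by apply: intr_inj; rewrite NE mul0r. Qed.

Lemma qr_normM x y : N (x * y) = N x * N y.
Proof. by apply: intr_inj; rewrite intrM !NE rmorphM; ring. Qed.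

Lemma qr_norm_int (k : int) : N k%:~R = k ^+ 2.
Proof. by apply: intr_inj; rewrite NE rmorph_int -intrM. Qed.

Lemma qr_normC x : N (cj x) = N x.
Proof. by apply: intr_inj; rewrite !NE cjK mulrC. Qed.

Lemma qr_norm_ge0 x : 0 <= N x.
Proof.
by have [->|/(qr_norm_gt0 qR)/ltW//] := eqVneq x 0; rewrite qr_norm0.
Qed.

Lemma qr_norm_eq0 x : (N x == 0) = (x == 0).
Proof.
apply/eqP/eqP => [Nx|->]; last exact: qr_norm0.
by apply/eqP; apply: contraT => /(qr_norm_gt0 qR); rewrite Nx.
Qed.

Lemma qr_mul_eq0 x y : (x * y == 0) = (x == 0) || (y == 0).
Proof. by rewrite -!qr_norm_eq0 qr_normM mulf_eq0. Qed.

Lemma qr_mulfI x : x != 0 -> injective ( *%R x).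
Proof.
move=> x0 y z /eqP; rewrite -subr_eq0 -mulrBr qr_mul_eq0 (negbTE x0) /=.
by rewrite subr_eq0 => /eqP.
Qed.

Lemma qr_dvdz (g m : int) x : m%:~R = g%:~R * x -> (g %| m)%Z.
Proof.
move=> mE; have : (g ^+ 2 %| m ^+ 2)%Z.
  by apply/dvdzP; exists (N x); rewrite -qr_norm_int mE qr_normM qr_norm_int mulrC.
by rewrite !dvdzE !abszX dvdn_pexp2r.
Qed.

Lemma intr_neq0 g : (0 < g)%N -> (g%:Z%:~R : R) != 0.
Proof. by move=> g0; apply/eqP => /(@intr_inj g 0) [] g0'; rewrite g0' in g0. Qed.

(* [g] generates the product of [I] and its conjugate. *)
Definition ideal_norm I g := [/\ (0 < g)%N,
  forall x y, I x -> I y -> exists z, x * cj y = g%:Z%:~R * z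
  & ideal_mul I (cj @` I) g%:Z%:~R].

Lemma ideal_normP I x :
  is_ideal I -> I x -> x != 0 -> exists g, ideal_norm I g.
Proof.
move=> iI Ix x0; pose H := ideal_mul I (cj @` I).
have iH : is_ideal H by apply: ideal_mul_ideal.
have HE y z : I y -> I z -> H (y * cj z).
  by move=> Iy Iz; apply: mem_ideal_mul => //; exists z.
pose G := [pred g : nat | (0 < g)%N && `[< H g%:Z%:~R >]].
have exG : exists g, G g.
  have Nx := qr_norm_gt0 qR x0; exists `|N x|%N.
  by rewrite /= absz_gt0 gt_eqF //=; apply/asboolP; rewrite gtz0_abs // NE; apply: HE.
case: (ex_minnP exG) => g /andP[g0 /asboolP Hg] gmin.
(* Division with remainder: the remainder of an integer of [H] by the least positive one stays in
   [H], so it vanishes. *)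
have gH (m : int) : H m%:~R -> (g %| m)%Z.
  move=> Hm; have /= r_lt := @ltz_pmod m g g0.
  have r_ge : 0 <= (m %% g)%Z by apply: modz_ge0; rewrite eqz_nat -lt0n.
  have Hr : H (m %% g)%Z%:~R.
    have -> : (m %% g)%Z = m - (m %/ g)%Z * g.
      by rewrite {2}(divz_eq m g) addrC addKr.
    rewrite rmorphB rmorphM /=; apply: is_idealB => //.
    exact: is_idealM.
  apply/dvdz_mod0P.
  case: (m %% g)%Z r_ge r_lt Hr => // r _ r_lt Hr.
  have [->//|r0] := posnP r.
  have Gr : G r by rewrite /= r0; apply/asboolP.
  by have := gmin r Gr; rewrite leqNgt -ltz_nat r_lt.
exists g; split=> // y z Iy Iz; apply: (qr_div qR).
- by rewrite eqz_nat -lt0n.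
- rewrite qr_normM qr_normC expr2; apply: dvdz_mul; apply: gH; rewrite NE; exact: HE.
apply: gH; rewrite TE rmorphM cjK; apply: is_idealD => //; first exact: HE.
by rewrite mulrC; apply: HE.
Qed.

(** This expression of [g] is a substitute for an inverse of [I]: an identity is multiplied by it,
    each summand is divided by [g], and [g] is cancelled. *)
Lemma ideal_norm_expand I g : ideal_norm I g ->
  exists n (a b : 'I_n -> R), [/\ forall i, I (a i), forall i, I (b i)
    & g%:Z%:~R = \sum_i a i * cj (b i)].
Proof.
case=> _ _ [n [a [b [Ia Ib gE]]]].
have [b' b'P] : {b' : 'I_n -> R & forall i, I (b' i) /\ cj (b' i) = b i}.
  apply: (@choice _ _ (fun i c => I c /\ cj c = b i)) => i.
  by have [c Ic ?] := Ib i; exists c.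
exists n, a, b'; split=> // [i|]; first by case: (b'P i).
by rewrite gE; apply: eq_bigr => i _; case: (b'P i) => _ ->.
Qed.

Lemma ideal_norm1 I : is_ideal I -> ideal_norm I 1 -> I 1.
Proof. by move=> iI [_ _ I1]; apply: ideal_mul_subl I1. Qed.

(** The quotient of [I] by [P], written without fractional ideals. *)
Definition colon_ideal I P : set R := [set y | forall p, P p -> I (p * y)].

(** To contain is to divide. With [g] the sum of the [a i * cj (b i)], each [x * cj (b i)] is
    [g * y i], and [x] is the sum of the [a i * y i] with [y i] in the colon ideal. *)
Lemma ideal_mul_quotient I P g : is_ideal I -> is_ideal P ->
    ideal_norm P g -> I `<=` P ->
  is_ideal (colon_ideal I P) /\ ideal_mul P (colon_ideal I P) = I.
Proof.
move=> iI iP nP IP; split; first split=> [p _|c x y Jx Jy p Pp].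
- by rewrite mulr0; case: iI.
- rewrite mulrDr mulrCA; apply: is_idealD => //; last exact: Jy.
  by apply: is_idealM => //; apply: Jx.
apply/seteqP; split.
  apply: ideal_mul_ind => [|x y|p y Pp Jy]; first by case: iI.
    exact: is_idealD.
  exact: Jy.
move=> x Ix; have [g0 Pdiv _] := nP.
have [n [a [b [Pa Pb gE]]]] := ideal_norm_expand nP.
have [y yP] : {y : 'I_n -> R & forall i, x * cj (b i) = g%:Z%:~R * y i}.
  apply: (@choice _ _ (fun i c => x * cj (b i) = g%:Z%:~R * c)) => i.
  by apply: Pdiv => //; apply: IP.
exists n, a, y; split=> // [i p Pp|].
  have [z zP] := Pdiv p (b i) Pp (Pb i).
  suff -> : p * y i = z * x by apply: is_idealM.
  apply: (qr_mulfI (intr_neq0 g0)).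
  by rewrite mulrCA -yP mulrCA zP mulrCA (mulrC x).
apply: (qr_mulfI (intr_neq0 g0)).
rewrite {1}gE mulr_suml mulr_sumr; apply: eq_bigr => i _.
by rewrite [RHS]mulrCA -yP; ring.
Qed.

(** Multiplying by the conjugate of [P] replaces [P] by the principal ideal of [g], which
    cancels. *)
Lemma ideal_mul_cancel P J J' g : is_ideal J' -> ideal_norm P g ->
  ideal_mul P J `<=` ideal_mul P J' -> J `<=` J'.
Proof.
move=> iJ' nP sJJ' y Jy; have [g0 Pdiv _] := nP.
have [n [a [b [Pa Pb gE]]]] := ideal_norm_expand nP.
suff H i : exists2 z, J' z & a i * cj (b i) * y = g%:Z%:~R * z.
  have [z J'z zE] : exists2 z, J' z & g%:Z%:~R * y = g%:Z%:~R * z.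
    rewrite {1}gE mulr_suml.
    apply: (@big_ind _ (fun u => exists2 z, J' z & u = g%:Z%:~R * z)).
    - by exists 0; rewrite ?mulr0; case: iJ'.
    - move=> _ _ [u Ju ->] [v Jv ->]; exists (u + v); rewrite ?mulrDr //.
      exact: is_idealD.
    by move=> i _; have [z] := H i; exists z.
  by move/(qr_mulfI (intr_neq0 g0)): zE => ->.
have : ideal_mul P J' (a i * y) by apply: sJJ'; apply: mem_ideal_mul.
rewrite mulrAC; move: (a i * y); apply: ideal_mul_ind.
- by exists 0; rewrite ?mul0r ?mulr0 //; case: iJ'.
- move=> u v [w Jw wE] [w' Jw' w'E]; exists (w + w'); first exact: is_idealD.
  by rewrite mulrDl wE w'E mulrDr.
move=> p z Pp J'z; have [e eP] := Pdiv p (b i) Pp (Pb i).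
by exists (e * z); [apply: is_idealM|rewrite mulrAC eP mulrA].
Qed.

(** Strict monotonicity of the norm, in contrapositive form: a larger ideal has a norm dividing that
    of the smaller one, and equal norms force equal ideals. This makes the norm a measure for
    minimality and induction. *)
Lemma ideal_norm_le I J g h : is_ideal I -> ideal_norm I g -> ideal_norm J h ->
  I `<=` J -> (g <= h)%N -> J `<=` I.
Proof.
move=> iI nI [h0 Jdiv _] IJ gh y Jy.
have [n [a [b [Ia Ib gE]]]] := ideal_norm_expand nI.
have hg : (h%:Z %| g%:Z)%Z.
  have [z zE] : exists z, g%:Z%:~R = h%:Z%:~R * z.
    rewrite gE; apply: (@big_ind _ (fun u => exists z, u = h%:Z%:~R * z)).
    - by exists 0; rewrite mulr0.
    - by move=> _ _ [u ->] [v ->]; exists (u + v); rewrite mulrDr.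
    by move=> i _; apply: Jdiv; apply: IJ.
  exact: qr_dvdz zE.
have {hg gh}gh : g = h.
  apply/eqP; rewrite eqn_leq gh dvdn_leq //; first by case: nI.
subst h; suff [z Iz zE] : exists2 z, I z & g%:Z%:~R * y = g%:Z%:~R * z.
  by move/(qr_mulfI (intr_neq0 h0)): zE => ->.
rewrite {1}gE mulr_suml.
apply: (@big_ind _ (fun u => exists2 z, I z & u = g%:Z%:~R * z)).
- by exists 0; rewrite ?mulr0; case: iI.
- move=> _ _ [u Ju ->] [v Jv ->]; exists (u + v); rewrite ?mulrDr //.
  exact: is_idealD.
move=> i _; have [e eE] := Jdiv _ _ Jy (IJ _ (Ib i)).
by exists (e * a i); [apply: is_idealM|rewrite -mulrA (mulrC _ y) eE; ring].
Qed.

Definition adjoin_ideal I x : set R := [set z | exists a y, I y /\ z = a * x + y].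

Lemma adjoin_idealP I x : is_ideal I -> is_ideal (adjoin_ideal I x).
Proof.
move=> iI; split; first by exists 0, 0; rewrite mul0r addr0; case: iI.
move=> c _ _ [a [y [Iy ->]]] [b [z [Iz ->]]]; exists (c * a + b), (c * y + z).
by split; [case: iI => _; apply|ring].
Qed.

Lemma mem_adjoin_ideal I x : is_ideal I -> adjoin_ideal I x x.
Proof. by case=> I0 _; exists 1, 0; rewrite mul1r addr0. Qed.

Lemma sub_adjoin_ideal I x : I `<=` adjoin_ideal I x.
Proof. by move=> y Iy; exists 0, y; rewrite mul0r add0r. Qed.

Lemma maximal_prime P : is_ideal P -> ~ P 1 ->
  (forall x, ~ P x -> adjoin_ideal P x 1) -> prime_ideal P.
Proof.
move=> iP P1 Pmax; apply/prime_idealP; split=> // x y Pxy.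
have [|/Pmax [a [p [Pp e]]]] := pselect (P x); [by left|right].
rewrite -[y]mul1r e mulrDl -mulrA; apply: is_idealD => //.
  exact: is_idealM.
by rewrite mulrC; apply: is_idealM.
Qed.

(** A proper ideal of least norm above [I] is maximal, so Zorn's lemma is avoided. *)
Lemma prime_ideal_exists I x : is_ideal I -> I x -> x != 0 -> ~ I 1 ->
  exists2 P, prime_ideal P & I `<=` P.
Proof.
move=> iI Ix x0 I1.
pose G := [pred g | `[< exists P, [/\ is_ideal P, I `<=` P, ~ P 1 & ideal_norm P g] >]].
have exG : exists g, G g.
  by have [g nI] := ideal_normP iI Ix x0; exists g => /=; apply/asboolP; exists I; split=> //.
case: (ex_minnP exG) => g /asboolP [P [iP IP P1 nP]] gmin.
exists P => //; apply: maximal_prime => // y Py; apply: contrapT => Py1.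
have sPy := @sub_adjoin_ideal P y.
have iPy := @adjoin_idealP P y iP.
have [h nPy] := ideal_normP iPy (sPy _ (IP _ Ix)) x0.
have gh : (g <= h)%N.
  apply: gmin => /=; apply/asboolP; exists (adjoin_ideal P y); split=> // z /IP.
  exact: sPy.
by apply: Py; apply: (ideal_norm_le iP nP nPy sPy gh); apply: mem_adjoin_ideal.
Qed.

(** Let [I] be [P] with [y] adjoined, and write [P] as [I] times [J]. Primality and [y] outside [P]
    put [J] inside [P], so [P] lies in [I] times [P]; cancelling [P] leaves 1 in [I]. *)
Lemma prime_ideal_maximal P x y : prime_ideal P -> P x -> x != 0 -> ~ P y ->
  adjoin_ideal P y 1.
Proof.
move=> /prime_idealP [iP P1 PM] Px x0 Py; set I := adjoin_ideal P y.
have iI : is_ideal I by apply: adjoin_idealP.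
have sPI : P `<=` I by apply: sub_adjoin_ideal.
have [g nI] := ideal_normP iI (sPI _ Px) x0.
have [h nP] := ideal_normP iP Px x0.
have [iJ PE] := ideal_mul_quotient iP iI nI sPI.
set J := colon_ideal P I in iJ PE.
have sJP : J `<=` P.
  by move=> z /(_ y (mem_adjoin_ideal y iP))/PM[].
apply: (@ideal_mul_cancel P setT I h) => //.
rewrite ideal_mulT // -{1}PE ideal_mulC; exact: ideal_mul_sub.
Qed.

Lemma prime_ideal_sub P Q x : prime_ideal P -> P x -> x != 0 -> prime_ideal Q ->
  P `<=` Q -> P = Q.
Proof.
move=> pP Px x0 /prime_idealP [iQ Q1 _] sPQ; apply/seteqP; split=> // y Qy.
apply: contrapT => /(prime_ideal_maximal pP Px x0) [a [p [Pp e]]].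
by apply: Q1; rewrite e; case: iQ => _; apply => //; apply: sPQ.
Qed.

Lemma prime_factorisation_exists I x : is_ideal I -> I x -> x != 0 ->
  exists s : seq (set R), {in s, forall P, prime_ideal P} /\
    \big[@ideal_mul R/setT]_(P <- s) P = I.
Proof.
move=> iI Ix x0; have [g] := ideal_normP iI Ix x0.
have [m] := ubnP g; elim: m I g iI Ix => // m IHm I g iI Ix /ltnSE gm nI.
have [I1|I1] := pselect (I 1).
  by exists [::]; split=> //; rewrite big_nil (ideal_eqT iI I1).
have [P pP IP] := prime_ideal_exists iI Ix x0 I1.
have /prime_idealP [iP P1 _] := pP.
have [k nP] := ideal_normP iP (IP _ Ix) x0.
have [iJ IE] := ideal_mul_quotient iI iP nP IP.
set J := colon_ideal I P in iJ IE.
have IJ : I `<=` J by move=> y Iy p _; apply: is_idealM.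
have [h nJ] := ideal_normP iJ (IJ _ Ix) x0.
have hg : (h < g)%N.
  (* If the norm did not drop, then [J = I], so [I] would equal [P] times [I], and cancelling [I]
     would make [P] the whole ring. *)
  rewrite ltnNge; apply/negP => gh; apply: P1.
  have JI : J = I by apply/seteqP; split=> //; apply: ideal_norm_le nI nJ _ gh.
  suff: [set: R] `<=` P by apply.
  apply: (@ideal_mul_cancel I setT P g) => //.
  by rewrite ideal_mulT // ideal_mulC -{1}IE JI.
have [s [ps sE]] := IHm J h iJ (IJ _ Ix) (leq_trans hg gm) nJ.
exists (P :: s); split; last by rewrite big_cons sE.
by move=> Q; rewrite inE => /predU1P [->|/ps].
Qed.

Lemma ideal_prod_ideal (s : seq (set R)) :
  {in s, forall P, is_ideal P} -> is_ideal (\big[@ideal_mul R/setT]_(P <- s) P).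
Proof.
elim: s => [|P s IHs] is'; rewrite ?big_nil // big_cons.
by apply: ideal_mul_ideal; apply/is'/mem_head.
Qed.

Lemma ideal_prod_sub (s : seq (set R)) P : {in s, forall P, is_ideal P} ->
  P \in s -> \big[@ideal_mul R/setT]_(P <- s) P `<=` P.
Proof.
elim: s => [//|Q s IHs] is' Ps; rewrite big_cons.
have {}is' : {in s, forall P, is_ideal P} /\ is_ideal Q.
  by split=> [I Is|]; apply: is'; rewrite inE ?Is ?orbT ?eqxx.
have [{}is' iQ] := is'.
move: Ps; rewrite inE => /predU1P [->|Ps]; first exact: ideal_mul_subl.
apply: subset_trans (IHs is' Ps); apply: ideal_mul_subr.
exact: ideal_prod_ideal.
Qed.

Lemma ideal_prod_sub_square (s : seq (set R)) P : {in s, forall P, is_ideal P} ->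
  (1 < count_mem P s)%N -> \big[@ideal_mul R/setT]_(P <- s) P `<=` ideal_mul P P.
Proof.
elim: s => [//|Q s IHs] is'; rewrite big_cons /=.
have {}is' : {in s, forall P, is_ideal P}.
  by move=> I Is; apply: is'; rewrite inE Is orbT.
have [->|QP] := eqVneq Q P; rewrite ?add1n ?add0n ?ltnS => sP; last first.
  apply: subset_trans (IHs is' sP); apply: ideal_mul_subr.
  exact: ideal_prod_ideal.
apply: ideal_mul_sub => //; apply: ideal_prod_sub => //.
by rewrite -has_pred1 has_count.
Qed.

(** The part of unique factorisation that is needed: a product of nonzero primes with at most one
    factor [Q] is not contained in the square of [Q]. The witness takes from each other factor an
    element outside [Q]. *)
Lemma square_free_prod (s : seq (set R)) Q z :
    prime_ideal Q -> Q z -> z != 0 ->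
    {in s, forall P, prime_ideal P /\ exists2 x, P x & x != 0} ->
    (count_mem Q s < 2)%N ->
  exists2 y, (\big[@ideal_mul R/setT]_(P <- s) P) y & ~ ideal_mul Q Q y.
Proof.
move=> pQ Qz z0; have /prime_idealP [iQ Q1 QM] := pQ.
have [g nQ] := ideal_normP iQ Qz z0.
(* Cancelling [Q] shows that it differs from its square. *)
have [q Qq QQq] : exists2 q, Q q & ~ ideal_mul Q Q q.
  apply: contrapT => H; apply: Q1; suff: [set: R] `<=` Q by apply.
  apply: (@ideal_mul_cancel Q setT Q g) => //; rewrite ideal_mulT // => q Qq.
  by apply: contrapT => QQq; apply: H; exists q.
have iQQ : is_ideal (ideal_mul Q Q) by apply: ideal_mul_ideal.
(* An element outside [Q] is invertible modulo [Q], so it can be cancelled in membership in the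
   square of [Q]. *)
have cop a y : ~ Q a -> Q y -> ideal_mul Q Q (a * y) -> ideal_mul Q Q y.
  move=> Qa Qy QQay; have [c [p [Qp e]]] := prime_ideal_maximal pQ Qz z0 Qa.
  rewrite -[y]mul1r e mulrDl -mulrA; apply: is_idealD => //.
    exact: is_idealM.
  exact: mem_ideal_mul.
have cop' a y : ~ Q a -> ideal_mul Q Q (a * y) -> ideal_mul Q Q y.
  move=> Qa QQay; apply: (cop a) => //.
  by have /QM[] : Q (a * y) by apply: ideal_mul_subl QQay.
elim: s => [|P s IHs] ps.
  by move=> _; exists 1; rewrite ?big_nil // => /(ideal_mul_subl iQ).
have {}ps P' : P' \in P :: s -> _ := ps P'.
have pss : {in s, forall P, prime_ideal P /\ exists2 x, P x & x != 0}.
  by move=> P' P's; apply: ps; rewrite inE P's orbT.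
rewrite /= big_cons; have [->|PQ] := eqVneq P Q; last first.
  rewrite add0n => /(IHs pss) [y sy QQy].
  have [pP [x Px x0]] := ps _ (mem_head _ _).
  have [a Pa Qa] : exists2 a, P a & ~ Q a.
    apply: contrapT => H; case/eqP: PQ; apply: (prime_ideal_sub pP Px) => // a Pa.
    by apply: contrapT => Qa; apply: H; exists a.
  exists (a * y); [exact: mem_ideal_mul|by move/(cop' _ _ Qa)].
rewrite add1n !ltnS leqn0 => s0.
suff [y sy Qy] : exists2 y, (\big[@ideal_mul R/setT]_(P <- s) P) y & ~ Q y.
  exists (q * y); first exact: mem_ideal_mul.
  by rewrite mulrC => /(cop' _ _ Qy).
elim: s pss s0 {IHs ps} => [|P' s IHs] pss; first by exists 1; rewrite ?big_nil.
rewrite /= addn_eq0 eqb0 big_cons => /andP [P'Q s0].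
have [pP [x Px x0]] := pss _ (mem_head _ _).
have [a Pa Qa] : exists2 a, P' a & ~ Q a.
  apply: contrapT => H; case/eqP: P'Q; apply: (prime_ideal_sub pP Px) => // a Pa.
  by apply: contrapT => Qa; apply: H; exists a.
have [|y sy Qy] := IHs _ s0.
  by move=> P'' P''s; apply: pss; rewrite inE P''s orbT.
by exists (a * y); [exact: mem_ideal_mul|move/QM => []].
Qed.

(** Removes the chosen factorisation from the definition; from here on square-freeness means lying
    in no square of a prime ideal. *)
Lemma square_freeP x : square_free x <->
  x != 0 /\ forall P, prime_ideal P -> ~ ideal_mul P P x.
Proof.
split=> -[x0 xP]; split=> // P pP; last first.
  rewrite ltnNge; apply/negP => Px; apply: (xP P pP); move: Px.
  (* The default [[::]] gives valuation 0, which contradicts a multiplicity of at least 2. *)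
  rewrite /ideal_valuation; case: xgetP => [s _ [ps sE]|//] sP.
  have is' : {in s, forall P, is_ideal P} by move=> Q /ps/prime_idealP[].
  by apply: (ideal_prod_sub_square is' sP); rewrite sE; apply: mem_principal_ideal.
move=> PPx; have := xP P pP; rewrite /ideal_valuation.
case: xgetP => [s _ [ps sE]|]; last first.
  have [s sP] := prime_factorisation_exists (principal_idealP x) (mem_principal_ideal x) x0.
  by move=> /(_ s).
move=> sP; have iP : is_ideal P by case/prime_idealP: pP.
have := @square_free_prod s P x pP (ideal_mul_subl iP PPx) x0 _ sP.
case=> [Q Qs|y].
  split; first exact: ps.
  exists x => //; apply: (@ideal_prod_sub s) => //.
    by move=> Q' /ps/prime_idealP [].
  by rewrite sE; apply: mem_principal_ideal.
rewrite sE => -[a _ <-]; apply; apply: is_idealM => //.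
exact: ideal_mul_ideal.
Qed.

(** Used as a sufficient test: if no square of a rational prime divides [N x], then [x] is
    square-free. *)
Lemma prime_square_norm P x : prime_ideal P -> x != 0 -> ideal_mul P P x ->
  exists l : nat, prime l /\ ((l ^ 2)%N%:Z %| N x)%Z.
Proof.
move=> /prime_idealP [iP P1 _] x0 PPx.
have [g nP] := ideal_normP iP (ideal_mul_subl iP PPx) x0.
have g1 : (1 < g)%N.
  have [g0 _ _] := nP; rewrite ltn_neqAle g0 andbT; apply/eqP => g1.
  by apply: P1; apply: ideal_norm1 => //; rewrite g1.
exists (pdiv g); split; first exact: pdiv_prime.
apply: (@dvdz_trans (g ^ 2)%N); first by rewrite dvdzE /= dvdn_exp2r // pdiv_dvd.
suff [z zE] : exists z, x * cj x = (g ^ 2)%N%:Z%:~R * z.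
  by apply: (@qr_dvdz _ _ z); rewrite NE.
have [g0 Pdiv _] := nP.
(* [x * cj x] is not additive in [x]; the claim is polarised so that each argument admits its own
   induction over sums. *)
suff H : forall u, ideal_mul P P u -> forall v, ideal_mul P P v ->
    exists z, v * cj u = (g ^ 2)%N%:Z%:~R * z by apply: H.
apply: ideal_mul_ind => [v _|u u' IHu IHu' v Pv|p q Pp Pq].
- by exists 0; rewrite rmorph0 !mulr0.
- have [z zE] := IHu v Pv; have [z' z'E] := IHu' v Pv.
  by exists (z + z'); rewrite rmorphD !mulrDr zE z'E.
apply: ideal_mul_ind => [|v v' [z zE] [z' z'E]|p' q' Pp' Pq'].
- by exists 0; rewrite mul0r mulr0.
- by exists (z + z'); rewrite mulrDl zE z'E mulrDr.
have [z zE] := Pdiv p' p Pp' Pp; have [z' z'E] := Pdiv q' q Pq' Pq.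
exists (z * z'); rewrite rmorphM mulrACA zE z'E -mulnn PoszM intrM; ring.
Qed.

End QuadraticIdeals.

(** * Square-free values of a definite binary form *)

Lemma PoszX2 (n : nat) : (n ^ 2)%N%:Z = n%:Z ^+ 2.
Proof. by rewrite -mulnn PoszM expr2. Qed.

Lemma prime_dvdzM (l : nat) (a b : int) : prime l ->
  (l %| a * b)%Z = (l %| a)%Z || (l %| b)%Z.
Proof. by move=> pl; rewrite !dvdzE abszM Euclid_dvdM. Qed.

Lemma prime_dvdzX2 (l : nat) (a : int) : prime l -> (l %| a ^+ 2)%Z = (l %| a)%Z.
Proof. by move=> pl; rewrite expr2 prime_dvdzM // orbb. Qed.

Lemma dvdz_sqr_weaken (l a : int) : (l ^+ 2 %| a)%Z -> (l %| a)%Z.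
Proof. by apply: dvdz_trans; rewrite expr2 dvdz_mulr. Qed.

Lemma dvdz_sqr (l a : int) : (l %| a)%Z -> (l ^+ 2 %| a ^+ 2)%Z.
Proof. by move=> la; rewrite !expr2 dvdz_mul. Qed.

Lemma dvdz_comb (d x y a b z : int) :
  (d %| x)%Z -> (d %| y)%Z -> z = a * x + b * y -> (d %| z)%Z.
Proof. by move=> dx dy ->; apply: rpredD; apply: dvdz_mull. Qed.

Lemma coprimez_prime2 (l : nat) (a : int) : prime l ->
  coprimez (l%:Z ^+ 2) a = ~~ (l %| a)%Z.
Proof.
by move=> pl; rewrite coprimez_pexpl // coprimezE /= prime_coprime // dvdzE.
Qed.

(** The norm form of the order Z[sqrt(-e)]. *)
Definition qform (e : nat) (u v : int) : int := u ^+ 2 + e%:Z * v ^+ 2.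

(** * Zeros of the form modulo the square of a prime *)

Section QuadraticFormPrime.
Variables e l : nat.
Hypotheses (l_pr : prime l) (l_ndvd : ~~ (l %| 2 * e)%N).

Let l_odd : (l %| 2%:Z)%Z = false.
Proof. by apply: negbTE; apply: contra l_ndvd => l2; apply: dvdn_mulr. Qed.

Let l_e : (l %| e%:Z)%Z = false.
Proof. by apply: negbTE; apply: contra l_ndvd => le; apply: dvdn_mull. Qed.

Lemma qform_dvd_prime (U V : int) :
  (l%:Z ^+ 2 %| qform e U V)%Z -> (l %| U)%Z = (l %| V)%Z.
Proof.
move=> /dvdz_sqr_weaken; rewrite /qform => H.
apply/idP/idP => [lU|lV].
  have : (l %| e%:Z * V ^+ 2)%Z.
    apply: (@dvdz_comb _ _ _ 1 (- U) _ H lU); ring.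
  by rewrite prime_dvdzM // l_e prime_dvdzX2.
rewrite -prime_dvdzX2 //.
apply: (@dvdz_comb _ _ _ 1 (- e%:Z * V) _ H lV); ring.
Qed.

(* The reduction of the form modulo [l ^ 2] splits, so its nonsingular zeros
   lie on two lines, those through [(U1, V1)] and [(U1, - V1)]. *)
Lemma qform_zero_cases (U V U1 V1 : int) :
    (l%:Z ^+ 2 %| qform e U V)%Z -> (l%:Z ^+ 2 %| qform e U1 V1)%Z ->
    ~~ (l %| V1)%Z ->
  [\/ (l %| V)%Z, (l%:Z ^+ 2 %| U * V1 - U1 * V)%Z
    | (l%:Z ^+ 2 %| U * V1 + U1 * V)%Z].
Proof.
move=> H H1 lV1; have [lV|lV] := boolP (l %| V)%Z; first by constructor 1.
(* Eliminating [e] leaves a difference of squares. Were both factors divisible by [l], so would be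
   [2 * U * V1], hence [U] and then [V]; so all of [l ^ 2] goes into one factor. *)
have HH : (l%:Z ^+ 2 %| (U * V1 - U1 * V) * (U * V1 + U1 * V))%Z.
  apply: (@dvdz_comb _ _ _ (V1 ^+ 2) (- V ^+ 2) _ H H1); rewrite /qform; ring.
have [lm|lm] := boolP (l %| U * V1 - U1 * V)%Z; last first.
  by constructor 3; rewrite -(Gauss_dvdzr _ (n := U * V1 - U1 * V)) ?coprimez_prime2.
constructor 2; rewrite -(Gauss_dvdzl _ (p := U * V1 + U1 * V)) ?coprimez_prime2 //.
apply: contra lV => lp; rewrite -(qform_dvd_prime H).
have : (l %| 2%:Z * (U * V1))%Z by apply: (@dvdz_comb _ _ _ 1 1 _ lm lp); ring.
by rewrite !prime_dvdzM // l_odd (negbTE lV1) orbF.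
Qed.

(** The zero set modulo [l ^ 2] is not closed under differences, but each of its three classes is:
    here the singular zeros, whose coordinates are both divisible by [l]. *)
Lemma qform_sub_singular (U V U' V' : int) :
    (l%:Z ^+ 2 %| qform e U V)%Z -> (l%:Z ^+ 2 %| qform e U' V')%Z ->
    (l %| V)%Z -> (l %| V')%Z ->
  (l%:Z ^+ 2 %| qform e (U - U') (V - V'))%Z.
Proof.
move=> /qform_dvd_prime e1 /qform_dvd_prime e2 lV lV'.
rewrite lV in e1; rewrite lV' in e2.
apply: rpredD; last apply: dvdz_mull; apply: dvdz_sqr; exact: rpredB.
Qed.

(** The sign [s] selects one of the two lines of nonsingular zeros. *)
Lemma qform_sub_regular (U V U' V' U1 V1 s : int) :
    (l%:Z ^+ 2 %| qform e U1 V1)%Z -> ~~ (l %| V1)%Z -> s ^+ 2 = 1 ->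
    (l%:Z ^+ 2 %| U * V1 - s * U1 * V)%Z ->
    (l%:Z ^+ 2 %| U' * V1 - s * U1 * V')%Z ->
  (l%:Z ^+ 2 %| qform e (U - U') (V - V'))%Z.
Proof.
move=> H1 lV1 s1 H H'; rewrite -(Gauss_dvdzr _ (n := V1 ^+ 2)); last first.
  by rewrite coprimez_prime2 // prime_dvdzX2.
have HB := rpredB H H'.
apply: (@dvdz_comb _ _ _ ((U - U') * V1 + s * U1 * (V - V')) ((V - V') ^+ 2) _ HB H1).
rewrite /qform; have -> : U1 ^+ 2 = s ^+ 2 * U1 ^+ 2 by rewrite s1 mul1r.
ring.
Qed.

End QuadraticFormPrime.

Lemma qform_gt0 (e : nat) (u v : int) : (0 < e)%N -> (u, v) != (0, 0) ->
  0 < qform e u v.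
Proof.
move=> e0; rewrite xpair_eqE negb_and /qform => /orP[] h.
  by rewrite ltr_wpDr ?exprn_even_gt0 // mulr_ge0 // sqr_ge0.
by rewrite ltr_wpDl ?sqr_ge0 // mulr_gt0 // exprn_even_gt0.
Qed.

Lemma dvdz_sqr_le (l : nat) (x : int) : 0 < x -> (l%:Z ^+ 2 %| x)%Z -> l%:Z ^+ 2 <= x.
Proof.
move=> x0; rewrite dvdzE abszX => /dvdn_leq; rewrite absz_gt0 gt_eqF // => /(_ isT).
by rewrite -lez_nat gtz0_abs.
Qed.

Lemma sqr_le_sqr (x t : int) : `|x| <= t -> x ^+ 2 <= t ^+ 2.
Proof.
rewrite ler_norml => /andP[h1 h2]; rewrite -subr_ge0 subr_sqr.
by rewrite mulr_ge0 //; lia.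
Qed.

Lemma qform_le (e : nat) (u v B : int) :
  u ^+ 2 <= B ^+ 2 -> v ^+ 2 <= B ^+ 2 -> qform e u v <= (e.+1%:Z * B) ^+ 2.
Proof.
rewrite -subr_ge0 -[v ^+ 2 <= _]subr_ge0 -[qform _ _ _ <= _]subr_ge0 => hu hv.
have -> : (e.+1%:Z * B) ^+ 2 - qform e u v =
    (B ^+ 2 - u ^+ 2) + e%:Z * (B ^+ 2 - v ^+ 2) + (e%:Z ^+ 2 + e%:Z) * B ^+ 2.
  by rewrite /qform -addn1 PoszD; ring.
apply: addr_ge0; first by apply: addr_ge0 => //; apply: mulr_ge0.
by rewrite mulr_ge0 ?addr_ge0 ?sqr_ge0.
Qed.

Lemma same_cell_sub (a b t : nat) : (a %/ t.+1 = b %/ t.+1)%N ->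
  `|a%:Z - b%:Z| <= t%:Z.
Proof.
move=> eab; have := divn_eq a t.+1; have := divn_eq b t.+1; rewrite eab.
have := @ltn_pmod a t.+1 isT; have := @ltn_pmod b t.+1 isT.
move: (b %/ t.+1 * t.+1)%N (a %% t.+1)%N (b %% t.+1)%N => k ra rb {eab}; lia.
Qed.

(* Distinct points of the lattice are at distance at least [l], so each cell of
   side [l %/ (1 + e) + 1] holds at most one of them. *)
Lemma card_separated_set (e l m : nat) (A : {set 'I_m * 'I_m}) :
    (0 < e)%N -> (0 < l)%N ->
    {in A &, forall z z' : 'I_m * 'I_m,
      (l%:Z ^+ 2 %| qform e (z.1%:Z - z'.1%:Z) (z.2%:Z - z'.2%:Z))%Z} ->
  (#|A| <= (m %/ (l %/ e.+1).+1).+1 ^ 2)%N.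
Proof.
move=> e0 l0 HA; set h := (l %/ e.+1).+1; set c := (m %/ h).+1.
have lt_c (i : 'I_m) : (i %/ h < c)%N by rewrite ltnS leq_div2r // ltnW.
pose f (z : 'I_m * 'I_m) := (Ordinal (lt_c z.1), Ordinal (lt_c z.2)).
suff /leq_card_in : {in A &, injective f} by rewrite card_prod card_ord.
move=> [i j] [i' j'] Az Az' /= [] ei ej.
have := HA _ _ Az Az' => /=; set u := _ - _; set v := _ - _ => H.
have bnd (a b : 'I_m) : (a %/ h = b %/ h)%N ->
    ((a : nat)%:Z - (b : nat)%:Z) ^+ 2 <= (l %/ e.+1)%N%:Z ^+ 2.
  by move=> eab; apply: sqr_le_sqr; apply: (@same_cell_sub a b h.-1).
have Hu := bnd _ _ ei; have Hv := bnd _ _ ej; rewrite -/u -/v in Hu Hv.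
have [/eqP|uv0] := eqVneq (u, v) (0, 0).
  rewrite xpair_eqE !subr_eq0 !eqz_nat => /andP[/eqP/val_inj -> /eqP/val_inj ->//].
have q0 := qform_gt0 e0 uv0.
have : l%:Z ^+ 2 <= qform e u v.
  exact: dvdz_sqr_le.
rewrite leNgt => /negP[]; rewrite /qform.
have := leq_trunc_div l e.+1; set t := (l %/ e.+1)%N in Hu Hv *.
(* Two points of one cell differ by at most [t] in each coordinate, so the form of the difference is
   at most [(e + 1) * t ^ 2]. For [t > 0] the inequality is strict because [e + 1 > 1]. *)
move=> tl; have {}tl : (e.+1 * t ^ 2 < l ^ 2)%N.
  have [->|t0] := posnP t; first by rewrite exp0n // muln0 expn_gt0 l0.
  apply: leq_trans (_ : ((t * e.+1) ^ 2 <= _)%N); last by rewrite leq_exp2r.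
  by rewrite expnMn mulnC -[X in (_ * X < _)%N]expn1 ltn_pmul2l ?expn_gt0 ?t0 // ltn_exp2l.
apply: le_lt_trans (_ : (e.+1 * t ^ 2)%N%:Z < _); last by rewrite -PoszX2.
have eS : e.+1%:Z = e%:Z + 1 by rewrite -addn1 PoszD.
rewrite PoszM PoszX2 eS mulrDl mul1r addrC lerD //.
by rewrite ler_wpM2l.
Qed.

(** * A sieve for square-free values along an arithmetic progression *)

Section Sieve.
Variables (e W : nat) (u0 v0 : int).
Hypothesis e_gt0 : (0 < e)%N.

Definition progression_form (i j : nat) : int :=
  qform e (u0 + W%:Z * i%:Z) (v0 + W%:Z * j%:Z).

(** The factor 3 counts the classes: singular zeros and the two lines through one fixed regular zero
    [z1]. Inside a class differences are zeros, so the points are separated. *)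
Lemma card_square_divisible (l m : nat) : prime l -> ~~ (l %| 2 * e)%N ->
    ~~ (l %| W)%N ->
  (#|[set z : 'I_m * 'I_m | (l%:Z ^+ 2 %| progression_form z.1 z.2)%Z]%SET| <=
   3 * (m %/ (l %/ e.+1).+1).+1 ^ 2)%N.
Proof.
move=> l_pr l_ndvd lW; set c := (_.+1 ^ 2)%N; set bad := [set z | _]%SET.
pose U (z : 'I_m * 'I_m) : int := u0 + W%:Z * z.1%:Z.
pose V (z : 'I_m * 'I_m) : int := v0 + W%:Z * z.2%:Z.
have badE z : z \in bad = (l%:Z ^+ 2 %| qform e (U z) (V z))%Z by rewrite inE.
have sep (A : {set 'I_m * 'I_m}) :
    {in A &, forall z z', (l%:Z ^+ 2 %| qform e (U z - U z') (V z - V z'))%Z} ->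
    (#|A| <= c)%N.
  move=> HA; apply: card_separated_set e_gt0 (prime_gt0 l_pr) _ => z z' Az Az'.
  (* Differences of points are [W] times differences of indices, and [W] is prime to [l]. *)
  rewrite -(Gauss_dvdzr _ (n := W%:Z ^+ 2)); last first.
    by rewrite coprimez_prime2 // prime_dvdzX2 // dvdzE.
  suff -> : W%:Z ^+ 2 * qform e (z.1%:Z - z'.1%:Z) (z.2%:Z - z'.2%:Z) =
            qform e (U z - U z') (V z - V z') by apply: HA.
  by rewrite /qform /U /V; ring.
have cover (A B C : {set 'I_m * 'I_m}) : bad \subset A :|: B :|: C ->
    (#|A| <= c)%N -> (#|B| <= c)%N -> (#|C| <= c)%N -> (#|bad| <= 3 * c)%N.
  move=> /subset_leq_card sb cA cB cC; apply: leq_trans sb _.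
  apply: leq_trans (leq_card_setU _ _).1 _.
  have -> : (3 * c = c + c + c)%N by rewrite !mulSn addn0 addnA.
  by apply: leq_add => //; apply: leq_trans (leq_card_setU _ _).1 (leq_add cA cB).
have A0 : (#|[set z in bad | (l %| V z)%Z]%SET| <= c)%N.
  apply: sep => z z'; rewrite !inE -!badE => /andP[bz lz] /andP[bz' lz'].
  by rewrite badE in bz; rewrite badE in bz'; apply: (qform_sub_singular l_pr l_ndvd).
have [[z1 bz1 lz1]|noz] := pselect (exists2 z, z \in bad & ~~ (l %| V z)%Z).
  rewrite badE in bz1.
  have A1 (s : int) : s ^+ 2 = 1 ->
      (#|[set z in bad | (l%:Z ^+ 2 %| (U z * V z1 - s * U z1 * V z)%R)%Z]%SET| <= c)%N.
    move=> s1; apply: sep => z z'; rewrite !inE => /andP[_ Hz] /andP[_ Hz'].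
    exact: (qform_sub_regular l_pr bz1 lz1 s1).
  apply: (cover _ _ _ _ A0 (A1 1 _) (A1 (- 1) _)); rewrite ?sqrrN ?expr1n //.
  apply/fintype.subsetP => z bz; rewrite !finset.in_setU !inE -!badE bz /= mul1r.
  rewrite badE in bz; rewrite mulN1r mulNr opprK.
  by case: (qform_zero_cases l_pr l_ndvd bz bz1 lz1) => ->; rewrite ?orbT.
apply: (cover _ _ _ _ A0 A0 A0); rewrite !finset.setUid; apply/fintype.subsetP => z bz.
rewrite !inE -badE bz /=; apply: contrapT => lz; apply: noz.
by exists z => //; apply/negP.
Qed.

(** Telescoping: the square of [f k.+1] is at most [C ^ 2 / (k + 1) ^ 2], hence at most
    [C ^ 2 * (1 / k - 1 / (k + 1))]. The shift to [k.+1] makes the sum run over integers above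
    [M]. *)
Lemma sum_square_le (f : nat -> nat) (C M L : nat) :
    (0 < M)%N -> (M <= L)%N -> (forall k, (f k * k <= C)%N) ->
  (M * (\sum_(M <= k < L) (f k.+1) ^ 2) <= C ^ 2)%N.
Proof.
move=> M0 ML fC.
suff H : ((\sum_(M <= k < L) (f k.+1) ^ 2)%N%:R : rat)
    <= (C%:R) ^+ 2 * (M%:R^-1 - L%:R^-1).
  rewrite -(ler_nat rat) natrM natrX mulrC -ler_pdivlMr ?ltr0n //.
  apply: le_trans H _; apply: ler_wpM2l; rewrite ?sqr_ge0 //.
  by rewrite gerBl invr_ge0 ler0n.
rewrite -(subnKC ML); elim: (L - M)%N => [|n IHn].
  by rewrite addn0 big_geq // subrr mulr0.
rewrite addnS big_nat_recr ?leq_addr //= natrD.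
set k := (M + n)%N in IHn *; apply: le_trans (lerD IHn (lexx _)) _.
have k0 : (0 : rat) < k%:R by rewrite ltr0n addn_gt0 M0.
have -> : (k.+1%:R : rat) = k%:R + 1 by rewrite -addn1 natrD.
have fk : (f k.+1)%:R * (k%:R + 1) <= (C%:R : rat).
  by have := fC k.+1; rewrite -(ler_nat rat) natrM -addn1 natrD.
have f0 : (0 : rat) <= (f k.+1)%:R by rewrite ler0n.
have [k1 k2] : (k%:R + 1 != 0 :> rat) /\ (k%:R != 0 :> rat) by split; lra.
rewrite natrX -subr_ge0.
set F := (f k.+1)%:R in fk f0 *; set x := k%:R in k0 fk k1 k2 *; set y := (C%:R : rat) in fk *.
move: (M%:R^-1) => w.
have -> : y ^+ 2 * (w - (x + 1)^-1) - (y ^+ 2 * (w - x^-1) + F ^+ 2) =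
    y ^+ 2 / x / (x + 1) - F ^+ 2.
  by field; rewrite ?k1 ?k2.
rewrite subr_ge0 -mulrA -invfM ler_pdivlMr ?mulr_gt0 //; last by lra.
apply: le_trans (_ : (F * (x + 1)) ^+ 2 <= _).
  by rewrite exprMn ler_wpM2l ?sqr_ge0 // expr2; nra.
by rewrite lerXn2r // nnegrE ?mulr_ge0 //; lra.
Qed.

(* A prime [l] that does not divide [W] exceeds the bound [M]; the points of
   an [m * m] box whose form is divisible by [l ^ 2] number at most
   [6 (m (e + 1) / l) ^ 2 + 6], and only [l <= L = O(m)] matter. The sum over
   [l > M] is below [m ^ 2 / 2 + 6 L], hence below [m ^ 2] for large [m]. *)
Lemma square_free_value :
    (forall l, prime l -> (l <= 12 * e.+1 ^ 2)%N -> (l %| W)%N) ->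
    (forall l i j, prime l -> (l %| W)%N ->
      ~~ (l%:Z ^+ 2 %| progression_form i j)%Z) ->
  exists i j, forall l, prime l -> ~~ (l%:Z ^+ 2 %| progression_form i j)%Z.
Proof.
set D := e.+1; set M := (12 * D ^ 2)%N => smallW goodW.
(* All values in the box are at most [L ^ 2], so only primes up to [L] matter; [m] is just large
   enough that [12 * L < m ^ 2]. *)
pose a := (`|u0| + `|v0|)%N; pose m := (12 * D * (a + W)).+1.
pose L := (D * (a + W * m))%N.
pose bad l := [set z : 'I_m * 'I_m | (l%:Z ^+ 2 %| progression_form z.1 z.2)%Z]%SET.
pose t l := (m %/ (l %/ D).+1)%N.
apply: contrapT => none.
have bad_cover (z : 'I_m * 'I_m) :
    exists2 k, (M <= k < L)%N & prime k.+1 && ~~ (k.+1 %| W)%N && (z \in bad k.+1).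
  have [l l_pr lz] : exists2 l, prime l & (l%:Z ^+ 2 %| progression_form z.1 z.2)%Z.
    apply: contrapT => nol; apply: none; exists z.1, z.2 => l l_pr.
    by apply/negP => lz; apply: nol; exists l.
  have lW : ~~ (l %| W)%N.
    by apply/negP => lW; have := goodW l z.1 z.2 l_pr lW; rewrite lz.
  have Ml : (M < l)%N by rewrite ltnNge; apply: contra lW; apply: smallW.
  (* A zero value would be divisible by 4, against the local hypothesis at 2, a divisor of [W]. *)
  have q0 : 0 < progression_form z.1 z.2.
    apply: qform_gt0 => //; apply/eqP => -[e1 e2].
    have : (2 %| W)%N by apply: smallW => //; apply: leq_trans (leq_pmulr 12 _); rewrite ?expn_gt0.
    move/(goodW 2%N z.1 z.2 isT); rewrite /progression_form e1 e2.
    by rewrite /qform expr0n mulr0 addr0 dvdz0.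
  have lq : l%:Z ^+ 2 <= progression_form z.1 z.2.
    exact: dvdz_sqr_le.
  have lL : (l <= L)%N.
    rewrite -(@leq_exp2r _ _ 2) // -lez_nat !PoszX2.
    apply: le_trans lq _; rewrite /progression_form.
    have bnd (w : int) (i : 'I_m) : (`|w| <= a)%N ->
        (w + W%:Z * i%:Z) ^+ 2 <= (a + W * m)%N%:Z ^+ 2.
      move=> wa; have im : (W * i <= W * m)%N by rewrite leq_mul2l ltnW ?orbT.
      apply: sqr_le_sqr; rewrite -PoszM; apply: le_trans (ler_normD _ _) _.
      by rewrite -abszE lez_nat leq_add.
    rewrite /L PoszM; apply: qform_le; apply: bnd; [exact: leq_addr|exact: leq_addl].
  exists l.-1; rewrite prednK ?prime_gt0 //.
    by rewrite lL -ltnS prednK ?prime_gt0 ?Ml.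
  by rewrite l_pr lW inE.
have card_bad : (m ^ 2 <= \sum_(M <= k < L) 3 * (t k.+1).+1 ^ 2)%N.
  have -> : (m ^ 2 = \sum_(z : 'I_m * 'I_m) 1)%N.
    by rewrite sum1_card card_prod card_ord.
  apply: (@leq_trans (\sum_(M <= k < L | prime k.+1 && ~~ (k.+1 %| W)%N) #|bad k.+1|)).
    under [X in (_ <= X)%N]eq_bigr do rewrite -sum1_card big_mkcond /=.
    rewrite exchange_big /=; apply: leq_sum => z _.
    have [k kML /andP[kP zk]] := bad_cover z.
    have ki : k \in index_iota M L by rewrite mem_index_iota.
    by rewrite (big_rem k ki) /= kP zk.
  rewrite big_mkcond /= big_nat_cond [X in (_ <= X)%N]big_nat_cond.
  apply: leq_sum => k /andP[/andP[Mk kL] _]; case: ifP => // /andP[k_pr kW].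
  apply: card_square_divisible => //.
  apply/negP => /dvdn_leq; rewrite muln_gt0 e_gt0 /= => /(_ isT).
  apply/negP; rewrite -ltnNge ltnS (leq_trans _ Mk) // leq_mul // /D -mulnn mulSn.
  exact: leq_trans (leqnSn e) (leq_addr _ _).
have tD k : (t k * k <= m * D)%N.
  apply: leq_trans (_ : (t k * ((k %/ D).+1 * D) <= _)%N).
    by rewrite leq_mul2l ltnW ?orbT // ltn_ceil.
  by rewrite mulnA leq_mul2r leq_trunc_div orbT.
have M0 : (0 < M)%N by [].
have [ML|LM] := leqP M L; last by rewrite big_geq ?(ltnW LM) // in card_bad.
have := sum_square_le M0 ML tD; set S := bigop _ _ _ => HS.
(* Termwise, [3 * (u + 1) ^ 2 <= 6 * u ^ 2 + 6]. *)
have {}card_bad : (m ^ 2 <= 6 * S + 6 * (L - M))%N.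
  apply: leq_trans card_bad _.
  rewrite [(6 * (L - M))%N]mulnC -sum_nat_const_nat /S big_distrr -big_split /=.
  by apply: leq_sum => k _; move: (t k.+1) => u; clear; nia.
(* The choice of [M]: the telescoping bound reads [12 * D ^ 2 * S <= (m * D) ^ 2]. *)
have {}HS : (12 * S <= m ^ 2)%N.
  by rewrite -(@leq_pmul2r (D ^ 2)) ?expn_gt0 // -expnMn mulnAC.
have HL : (12 * L < m ^ 2)%N.
  apply: leq_ltn_trans (_ : (12 * D * (a + W) * m < _)%N).
    by rewrite /L mulnA -[leqRHS]mulnA leq_mul2l mulnDl leq_add2r leq_pmulr ?orbT.
  by rewrite -mulnn ltn_pmul2r.
by clear -card_bad HS HL; lia.
Qed.

End Sieve.

(** * Cyclic and dihedral groups of maps *)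

Section CyclicDihedralMaps.
Variables (T : Type) (rho tau : T -> T) (n : nat).
Hypotheses (n_gt1 : (1 < n)%N) (rho_n : iter n rho =1 id).

Lemma iter_modn k : iter (k %% n) rho = iter k rho.
Proof.
apply/funext => x; rewrite [in RHS](divn_eq k n) addnC iterD; congr iter.
by elim: (k %/ n)%N => [//|q IHq]; rewrite mulSn iterD -IHq rho_n.
Qed.

Lemma comp_isog_cyclic (G : set (T -> T)) :
    G = range (fun k => iter k rho) ->
    (forall i j, (i < n)%N -> (j < n)%N -> iter i rho = iter j rho -> i = j) ->
  comp_isog G 'Z_n.
Proof.
move=> -> inj; pose f (k : 'Z_n) : T -> T := iter k rho.
have lt_n (i : 'Z_n) : (i < n)%N by rewrite -[X in (_ < X)%N](Zp_cast n_gt1).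
exists f => [i j|].
  apply/funext => x /=; rewrite /f -iterD -(iter_modn (i + j)).
  by congr (iter _ rho x); apply: (congr1 (modn (i + j)) (Zp_cast n_gt1)).
split=> [k _|i j _ _ /inj H|_ [k _ <-]]; first by exists k.
  by apply: val_inj; apply: H.
by exists (inZp k) => //; rewrite /f /= Zp_cast // iter_modn.
Qed.

(** The presentation of the dihedral group supplies generators [x], [y] with the same relations as
    [rho], [tau]. The map is defined through the normal form [x ^ i * y ^ j], so the uniqueness of
    the exponents modulo [n] and 2 is what makes it well defined. *)
Lemma comp_isog_dihedral (G : set (T -> T)) :
    involutive tau -> (forall x, tau (rho x) = iter n.-1 rho (tau x)) ->
    G = [set iter ij.1 rho \o iter ij.2 tau | ij in [set: nat * nat]] ->
    (forall i j i' j', (i < n)%N -> (j < 2)%N -> (i' < n)%N -> (j' < 2)%N ->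
       iter i rho \o iter j tau = iter i' rho \o iter j' tau -> i = i' /\ j = j') ->
  comp_isog G 'D_(2 * n).
Proof.
move=> tauK tau_rho -> inj; have [x [y [oG xn y2 xy GE]]] :
    exists x y : 'D_(2 * n), [/\ #|'D_(2 * n)| = (n * 2)%N, (x ^+ n = 1)%g,
      (y ^+ 2 = 1)%g, (y * x = x ^+ n.-1 * y)%g &
      forall g, exists i j, g = (x ^+ i * y ^+ j)%g].
  rewrite mul2n; set gT := 'D_(n.*2).
  have oG : #|gT| = (n * 2)%N by rewrite muln2 -(card_dihedral n_gt1) cardsT.
  have /existsP [[x y] /= /eqP [defG xn y2 xy]] :
      ([set: gT]%SET \homg Grp (x : y : x ^+ n, y ^+ 2, x ^ y = x^-1))%g.
    exact: isoGrp_hom (Grp_dihedral n_gt1).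
  have {}defG : (<[x]> * <[y]> = [set: gT]%SET)%g.
    by rewrite -norm_joinEr // norms_cycle xy groupV cycle_id.
  exists x, y; split=> // [|g].
    have -> : (x ^+ n.-1 = x^-1)%g.
      by apply/eqP; rewrite eq_sym eq_invg_mul -expgS prednK ?xn // ltnW.
    by apply: (mulgI y^-1)%g; rewrite mulKg -conjgE conjVg xy invgK.
  have : g \in (<[x]> * <[y]>)%g by rewrite defG.
  by case/mulsgP => _ _ /cycleP [i ->] /cycleP [j ->] ->; exists i, j.
set gT := ('D_(2 * n))%type in x y oG xn y2 xy GE *.
pose e (ij : 'I_n * 'I_2) : gT := (x ^+ ij.1 * y ^+ ij.2)%g.
have n0 : (0 < n)%N := ltnW n_gt1.
have eE i j : (x ^+ i * y ^+ j)%g = e (Ordinal (ltn_pmod i n0), Ordinal (ltn_pmod j (ltn0Sn 1))).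
  by rewrite /e /= !expg_mod.
(* The [n * 2] exponent pairs reach all of a group with [n * 2] elements. *)
have e_inj : injective e.
  suff : #|e @: [set: 'I_n * 'I_2]%SET| == #|[set: 'I_n * 'I_2]%SET|.
    by move/imset_injP => H u v; apply: H; rewrite inE.
  rewrite [X in _ == X]cardsT card_prod !card_ord -oG -cardsT; apply/eqP; congr #|pred_of_set _|.
  apply/setP => g; rewrite !inE; have [i [j ->]] := GE g.
  by rewrite eE; apply: imset_f; rewrite inE.
pose F i j : T -> T := iter i rho \o iter j tau.
have tau2 k : iter (k %% 2) tau = iter k tau.
  apply/funext => z; rewrite [in RHS](divn_eq k 2) addnC iterD; congr iter.
  by elim: (k %/ 2)%N => [//|q IHq]; rewrite mulSn iterD -IHq /= tauK.
have F_mod i j : F (i %% n)%N (j %% 2)%N = F i j by rewrite /F iter_modn tau2.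
have Fwd i j i' j' : (x ^+ i * y ^+ j = x ^+ i' * y ^+ j')%g -> F i j = F i' j'.
  by rewrite !eE => /e_inj [ii jj]; rewrite -F_mod ii jj F_mod.
have [f fP] : {f : gT -> T -> T & forall g,
    exists ij, g = (x ^+ ij.1 * y ^+ ij.2)%g /\ f g = F ij.1 ij.2}.
  apply: (@boolp.choice _ _ (fun g h =>
    exists ij, g = (x ^+ ij.1 * y ^+ ij.2)%g /\ h = F ij.1 ij.2)) => g.
  by have [i [j ->]] := GE g; exists (F i j), (i, j).
have fE i j : f (x ^+ i * y ^+ j)%g = F i j.
  by have [[i' j'] /= [/Fwd -> ->]] := fP (x ^+ i * y ^+ j)%g.
have y_x k : (y * x ^+ k = x ^+ (n.-1 * k) * y)%g.
  elim: k => [|k IHk]; first by rewrite muln0 mulg1 mul1g.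
  by rewrite expgSr mulgA IHk -mulgA xy mulgA -expgD mulnS addnC.
have tau_iter k z : tau (iter k rho z) = iter (n.-1 * k) rho (tau z).
  elim: k => [|k IHk]; first by rewrite muln0.
  by rewrite iterS tau_rho IHk -iterD mulnS.
exists f => [g h|].
  have [i [j ->]] := GE g; have [i' [j' ->]] := GE h.
  rewrite -(expg_mod j y2) 2!fE /F; case: (j %% 2)%N (ltn_pmod j (ltn0Sn 1)) => [|[|//]] _.
    rewrite mulg1 mulgA -expgD fE /F; apply/funext => z /=.
    by rewrite iterD.
  rewrite expg1 mulgA -[(_ * y * _)%g]mulgA y_x mulgA -mulgA -expgD -expgS fE /F.
  by apply/funext => z /=; rewrite tau_iter iterD.
split=> [g _|g h _ _|_ [[i j] _ <-]].
- by have [i [j ->]] := GE g; rewrite fE; exists (i, j).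
- have [i [j ->]] := GE g; have [i' [j' ->]] := GE h; rewrite !fE !eE.
  rewrite -(F_mod i) -(F_mod i') => /inj [] *; rewrite ?ltn_pmod //.
  by congr e; congr pair; apply: val_inj.
by exists (x ^+ i * y ^+ j)%g; rewrite ?fE.
Qed.

End CyclicDihedralMaps.

(** * Maps preserving square-freeness *)

(** A prime factor [p] of [e * q ^ 2 + 1] is large when [q] is a factorial, and [- e] is a square
    modulo [p] since [(e * q) ^ 2 + e = e * (e * q ^ 2 + 1)]. The summand 2 in [k + 2] makes [p]
    odd. *)
Lemma large_split_prime (e k : nat) : (0 < e)%N ->
  exists p : nat, exists r : int, [/\ prime p, (k < p)%N, (p%:Z ^+ 2 %| r ^+ 2 + e%:Z)%Z
    & ~~ (p %| 2%:Z * r)%Z].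
Proof.
move=> e0; pose q := (k + 2)`!; pose m := (e * q ^ 2).+1; pose p := pdiv m.
have p_pr : prime p by rewrite pdiv_prime // ltnS muln_gt0 e0 expn_gt0 fact_gt0.
have pm : (p %| m)%N := pdiv_dvd m.
have peq : ~~ (p %| e * q ^ 2)%N.
  by apply: contraL pm => h; rewrite /m -addn1 dvdn_addr // Euclid_dvd1.
have kp : (k + 2 < p)%N.
  rewrite ltnNge; apply: contra peq => kp; rewrite dvdn_mull // Euclid_dvdX //.
  by rewrite dvdn_fact // prime_gt0.
pose r0 : int := (e * q)%N%:Z.
have pr0 : ~~ (p %| 2%:Z * r0)%Z.
  rewrite prime_dvdzM // negb_or !dvdzE /=; apply/andP; split.
    by apply/negP => /dvdn_leq => /(_ isT); lia.
  by apply: contra peq; rewrite -mulnn mulnA; apply: dvdn_mulr.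
have /coprimezP [[u v] /= uv] : coprimez p%:Z (2%:Z * r0).
  by rewrite coprimezE /= prime_coprime // -dvdzE.
have [c cE] : exists c, r0 ^+ 2 + e%:Z = c * p%:Z.
  apply/dvdzP; have -> : r0 ^+ 2 + e%:Z = e%:Z * m%:Z.
    have -> : m%:Z = e%:Z * q%:Z ^+ 2 + 1 by rewrite /m -addn1 PoszD PoszM PoszX2.
    by rewrite /r0 PoszM; ring.
  by apply: dvdz_mull; rewrite dvdzE.
(* A Newton step lifts the root [r0] from [p] to [p ^ 2]; [v] inverts the derivative [2 * r0] modulo
   [p]. *)
exists p, (r0 - v * (r0 ^+ 2 + e%:Z)); split=> //; first by lia.
  apply/dvdzP; exists (c * u + v ^+ 2 * c ^+ 2).
  have -> : (r0 - v * (r0 ^+ 2 + e%:Z)) ^+ 2 + e%:Z =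
    (r0 ^+ 2 + e%:Z) * (1 - v * (2%:Z * r0)) + v ^+ 2 * (r0 ^+ 2 + e%:Z) ^+ 2 by ring.
  by rewrite -uv cE; ring.
apply: contra pr0 => H.
have pc : (p %| c * p%:Z)%Z by apply: dvdz_mull.
by apply: (@dvdz_comb _ _ _ 1 (2%:Z * v) _ H pc); rewrite -cE; ring.
Qed.

Section Stabiliser.
Variables (R : comNzRingType) (cj : {rmorphism R -> R}) (N T : R -> int).
Hypothesis qR : quadratic_ring cj N T.
Variables (e : nat) (s : R).
Hypotheses (e_gt0 : (0 < e)%N) (s_sqr : s * s = - e%:Z%:~R) (cj_s : cj s = - s).

Let cjK := qr_conjK qR.
Let intr_inj := qr_intr_inj qR.
Let NE := qr_normE qR.
Let TE := qr_traceE qR.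

Lemma qr_traceD x y : T (x + y) = T x + T y.
Proof. by apply: intr_inj; rewrite intrD !TE rmorphD; ring. Qed.

Lemma qr_traceZ (k : int) x : T (k%:~R * x) = k * T x.
Proof. by apply: intr_inj; rewrite intrM !TE rmorphM rmorph_int; ring. Qed.

Lemma qr_trace_int (k : int) : T k%:~R = 2%:Z * k.
Proof. by apply: intr_inj; rewrite intrM !TE rmorph_int; ring. Qed.

Lemma qr_traceC x y : T (x * cj y) = T (y * cj x).
Proof. by apply: intr_inj; rewrite !TE !rmorphM !cjK; ring. Qed.

Lemma qr_normD x y : N (x + y) = N x + T (x * cj y) + N y.
Proof.
by apply: intr_inj; rewrite !intrD !NE TE rmorphD rmorphM cjK; ring.
Qed.

Lemma qr_normZ (k : int) x : N (k%:~R * x) = k ^+ 2 * N x.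
Proof. by rewrite (qr_normM qR) (qr_norm_int qR). Qed.

Lemma qr_norm_comb (u v : int) : N (u%:~R + v%:~R * s) = qform e u v.
Proof.
apply: intr_inj; rewrite NE rmorphD rmorphM !rmorph_int cj_s /qform.
rewrite intrD intrM !rmorphXn /=.
have -> : (u%:~R + v%:~R * s) * (u%:~R + v%:~R * - s) =
  u%:~R ^+ 2 - v%:~R ^+ 2 * (s * s) :> R by ring.
by rewrite s_sqr; ring.
Qed.

(** Coordinates are read off the trace form; the factor [2 * e] makes them integers even for
    elements outside Z[s]. *)
Lemma qr_coordinates x :
  (2%:Z * e%:Z)%:~R * x = (e%:Z * T x)%:~R + (- T (x * s))%:~R * s.
Proof.
rewrite !intrM rmorphN /= !TE rmorphM cj_s.
have -> : - (x * s + cj x * - s) * s = (cj x - x) * (s * s) by ring.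
by rewrite s_sqr; ring.
Qed.

Let two_e : ((2%:Z * e%:Z)%:~R : R) != 0.
Proof. by rewrite -PoszM; apply: (intr_neq0 qR); rewrite muln_gt0. Qed.

Section SquareFreeStable.
Variables A B : R -> R.
Hypotheses (A_lin : Zlinear A) (B_lin : Zlinear B).
Hypotheses (AK : cancel A B) (BK : cancel B A).
Hypothesis A_sqf : A @` (@square_free R) `<=` @square_free R.

Lemma ZlinearE (F : R -> R) (k : int) x y : Zlinear F ->
  F (k%:~R * x + y) = k%:~R * F x + F y.
Proof. by move=> F_lin; rewrite !mulrzl F_lin. Qed.

Lemma Zlinear0 (F : R -> R) : Zlinear F -> F 0 = 0.
Proof.
move=> F_lin; have /eqP := F_lin 1 0 0; rewrite !mulr1z addr0 -{1}[F 0]addr0.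
by rewrite (inj_eq (addrI _)) eq_sym => /eqP.
Qed.

Lemma ZlinearE0 (F : R -> R) (k : int) x : Zlinear F ->
  F (k%:~R * x) = k%:~R * F x.
Proof.
by move=> F_lin; rewrite -[k%:~R * x]addr0 ZlinearE // Zlinear0 // addr0.
Qed.

Lemma square_divisible_lift (x : R) (p : nat) (r b : int) :
    prime p -> (p%:Z ^+ 2 %| r ^+ 2 + e%:Z)%Z -> ~~ (p %| 2%:Z * r)%Z ->
  ~ square_free (b%:~R * (s - r%:~R) + (p%:Z ^+ 2)%:~R * x).
Proof.
move=> p_pr /dvdzP [c cE] p2r; apply/(square_freeP qR) => -[_ nsq].
(* A proper ideal containing [p] and [s - r]. Described by this divisibility, it excludes 1 by a
   trace: [T (s + r) = 2 * r] is not divisible by [p]. *)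
pose I : set R := [set z | exists w, z * (s + r%:~R) = p%:Z%:~R * w].
have iI : is_ideal I.
  split; first by exists 0; rewrite mul0r mulr0.
  move=> a z z' [w wE] [w' w'E]; exists (a * w + w').
  by rewrite mulrDl -mulrA wE w'E; ring.
have Ip : I p%:Z%:~R by exists (s + r%:~R).
have prodE : (s - r%:~R) * (s + r%:~R) = (p%:Z ^+ 2)%:~R * - c%:~R.
  have -> : (s - r%:~R) * (s + r%:~R) = s * s - r%:~R ^+ 2 by ring.
  rewrite s_sqr -rmorphXn /= -rmorphN -rmorphB /= -opprD addrC cE.
  by rewrite -rmorphN -rmorphM /=; congr _%:~R; ring.
have Isr : I (s - r%:~R).
  by exists (p%:Z%:~R * - c%:~R); rewrite prodE mulrA -rmorphM -expr2.
have I1 : ~ I 1.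
  move=> [w wE]; case/negP: p2r.
  have : T (s + r%:~R) = p%:Z * T w by rewrite -qr_traceZ -wE mul1r.
  rewrite qr_traceD qr_trace_int => H; apply/dvdzP; exists (T w).
  rewrite [RHS]mulrC -H; suff -> : T s = 0 by rewrite add0r.
  by apply: intr_inj; rewrite TE cj_s subrr.
have p0 := intr_neq0 qR (prime_gt0 p_pr).
have [P pP IP] := prime_ideal_exists qR iI Ip p0 I1.
have /prime_idealP [iP _ _] := pP.
have iPP : is_ideal (ideal_mul P P) by apply: ideal_mul_ideal.
apply: (nsq P pP).
have PPp : ideal_mul P P (p%:Z ^+ 2)%:~R.
  by rewrite expr2 intrM; apply: mem_ideal_mul; apply: IP.
apply: is_idealD => //; last by rewrite mulrC; apply: is_idealM.
apply: is_idealM => //.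
have /coprimezP [[u v] /= uv] : coprimez (p%:Z ^+ 2) (2%:Z * r).
  by rewrite coprimez_prime2.
(* Since [2 * r * (s - r) = (s - r) * (s + r) - (s - r) ^ 2] and [2 * r] is invertible modulo
   [p ^ 2], the element [s - r] itself lies in the square of [P]. *)
have -> : s - r%:~R = (u%:~R * (s - r%:~R) - v%:~R * c%:~R) * (p%:Z ^+ 2)%:~R
    - v%:~R * ((s - r%:~R) * (s - r%:~R)).
  have uvR : u%:~R * (p%:Z ^+ 2)%:~R + v%:~R * (2%:Z * r)%:~R = 1 :> R.
    by rewrite -!intrM -intrD uv.
  have two_r : (2%:Z * r)%:~R * (s - r%:~R) =
      (p%:Z ^+ 2)%:~R * - c%:~R - (s - r%:~R) * (s - r%:~R).
    by rewrite -prodE intrM; ring.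
  have := congr1 ( *%R^~ (s - r%:~R)) uvR.
  by rewrite /= mul1r mulrDl -[v%:~R * _ * _]mulrA two_r => {1}<-; ring.
apply: is_idealB => //; first exact: is_idealM.
apply: is_idealM => //; apply: mem_ideal_mul; exact: IP.
Qed.

(* Otherwise the sieve, run in the preimage under [A] of the square of the
   prime ideal [(p, s - r)], yields a square-free element of that lattice. *)
Lemma square_divides_norm (p : nat) (r : int) :
    prime p -> (12 * e.+1 ^ 2 < p)%N ->
    (p%:Z ^+ 2 %| r ^+ 2 + e%:Z)%Z -> ~~ (p %| 2%:Z * r)%Z ->
  (p%:Z ^+ 2 %| N (B (s - r%:~R)))%Z.
Proof.
move=> p_pr Mp pr p2r; set x0 := B _; apply/negPn/negP => px0.
(* [Q] contains all primes that the sieve wants in [W], is a multiple of [2 * e] so that [Q * x0]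
   lies in Z[s], and is prime to [p] because [M < p]. *)
set M := (12 * e.+1 ^ 2)%N in Mp; pose Q := M`!.
have [q qE] : exists q, Q = (q * (2 * e))%N.
  apply/dvdnP; rewrite /Q; apply: dvdn_fact; rewrite muln_gt0 e_gt0 /= /M; nia.
have pQ : ~~ (p %| Q)%N.
  rewrite /Q; apply/negP; elim: M Mp {q qE Q} => [|m IHm] mp.
    by rewrite fact0 Euclid_dvd1.
  rewrite factS Euclid_dvdM // => /orP[/dvdn_leq|]; first by move=> /(_ isT); lia.
  by apply: IHm; apply: ltnW.
have /coprimezP [[a b] /= ab] : coprimez (p%:Z ^+ 2) (Q%:Z ^+ 2).
  by rewrite coprimez_prime2 // prime_dvdzX2 // dvdzE.
pose u1 := q%:Z * (e%:Z * T x0); pose v1 := q%:Z * - T (x0 * s).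
have x0E : Q%:Z%:~R * x0 = u1%:~R + v1%:~R * s.
  rewrite qE !PoszM intrM -mulrA qr_coordinates /u1 /v1; ring.
(* Chinese remainders: with [a * p ^ 2 + b * Q ^ 2 = 1], the point [X i j] is congruent to [x0]
   modulo [p ^ 2] and to 1 modulo [Q]. *)
pose u0 := b * Q%:Z * u1 + p%:Z ^+ 2 * a; pose v0 := b * Q%:Z * v1.
pose W := (p ^ 2 * Q)%N.
pose X (i j : nat) := (u0 + W%:Z * i%:Z)%:~R + (v0 + W%:Z * j%:Z)%:~R * s.
pose z (i j : nat) := a%:~R + Q%:Z%:~R * (i%:Z%:~R + j%:Z%:~R * s).
have WE : W%:Z = p%:Z ^+ 2 * Q%:Z by rewrite /W PoszM.
have XE i j : X i j = (b * Q%:Z ^+ 2)%:~R * x0 + (p%:Z ^+ 2)%:~R * z i j.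
  have -> : (b * Q%:Z ^+ 2)%:~R * x0 = (b * Q%:Z)%:~R * (u1%:~R + v1%:~R * s).
    by rewrite -x0E !intrM; ring.
  by rewrite /X /z /u0 /v0 WE !(intrD, intrM); ring.
have NX i j : N (X i j) = progression_form e W u0 v0 i j by rewrite qr_norm_comb.
have [|l i j l_pr|i [j sqf]] := @square_free_value e W u0 v0 e_gt0.
- by move=> l l_pr lM; apply/dvdn_mull/dvdn_fact; rewrite prime_gt0.
- rewrite Euclid_dvdM // Euclid_dvdX // andbT.
  (* At a prime [l] of [Q] the norm is congruent to [(p ^ 2 * a) ^ 2], a unit modulo [l]; at [p] it
     is congruent to [N x0], where the assumption [px0] applies. *)
  have [/eqP|lp lQ] := boolP (l == p); last first.
    have {}lQ : (l %| Q%:Z)%Z.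
      by move: lQ; rewrite dvdn_prime2 // (negbTE lp) /= dvdzE.
    apply/negP => /dvdz_sqr_weaken lF.
    have : (l %| (p%:Z ^+ 2 * a) ^+ 2)%Z.
      pose g := b * u1 + p%:Z ^+ 2 * i%:Z; pose h := b * v1 + p%:Z ^+ 2 * j%:Z.
      apply: (@dvdz_comb _ _ _ 1
        (- (Q%:Z * g ^+ 2 + 2%:Z * g * (p%:Z ^+ 2 * a) + e%:Z * (Q%:Z * h ^+ 2))) _ lF lQ).
      by rewrite /progression_form /qform /u0 /v0 WE /g /h; ring.
    rewrite prime_dvdzX2 // => lp2a.
    have : (l %| 1%R)%Z by apply: (@dvdz_comb _ _ _ 1 (b * Q%:Z) _ lp2a lQ); rewrite mul1r -ab; ring.
    by rewrite dvdzE /= Euclid_dvd1.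
  move=> -> _; rewrite -NX XE; apply: contra px0.
  have -> : (b * Q%:Z ^+ 2)%:~R * x0 + (p%:Z ^+ 2)%:~R * z i j =
            x0 + (p%:Z ^+ 2)%:~R * (z i j - a%:~R * x0).
    have -> : b * Q%:Z ^+ 2 = 1 - a * p%:Z ^+ 2 by rewrite -ab; ring.
    rewrite intrB intrM; ring.
  rewrite qr_normD qr_normZ rmorphM rmorph_int mulrCA qr_traceZ => H.
  have pp : (p%:Z ^+ 2 %| p%:Z ^+ 2)%Z by [].
  apply: (@dvdz_comb _ _ _ 1 (- (T (x0 * cj (z i j - a%:~R * x0)) +
     p%:Z ^+ 2 * N (z i j - a%:~R * x0))) _ H pp); ring.
have Xsqf : square_free (X i j).
  have X0 : X i j != 0.
    by apply: contraTneq (sqf 2%N isT) => X0; rewrite -NX X0 (qr_norm0 qR) dvdz0.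
  apply/(square_freeP qR); split=> // P pP PPX.
  have [l [l_pr]] := prime_square_norm qR pP X0 PPX.
  by rewrite NX PoszX2; apply/negP/sqf.
have := A_sqf (imageP A Xsqf); rewrite XE ZlinearE // ZlinearE0 //.
rewrite /x0 BK; exact: square_divisible_lift.
Qed.

Lemma qr_trace0_norm (z : R) : T z = 0 -> N z = e%:Z -> z = s \/ z = - s.
Proof.
move=> Tz Nz; have := qr_coordinates z; rewrite Tz mulr0 add0r.
move: (- T (z * s)) => t zE.
have : t ^+ 2 = (2%:Z * e%:Z) ^+ 2.
  have tE : t%:~R * s = (0 : int)%:~R + t%:~R * s by rewrite add0r.
  have := congr1 N zE; rewrite qr_normZ Nz tE qr_norm_comb /qform expr0n add0r.
  by rewrite mulrC => /mulfI -> //; rewrite eqz_nat -lt0n.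
move/eqP; rewrite eqf_sqr => /orP[] /eqP tE; rewrite tE in zE.
  by left; apply: (qr_mulfI qR two_e).
by right; apply: (qr_mulfI qR two_e); rewrite zE rmorphN mulrN mulNr.
Qed.

(** [t] and [D] measure how far [N (B x)] is from a multiple of [N x]. The congruences at [r] and
    [- r] give [p ^ 2] dividing [2 * r * t], and then [2 * D]; as [p] exceeds [t] and [2 * D] in
    absolute value, both vanish. *)
Lemma square_free_stable_inverse :
  exists alpha, N alpha = 1 /\
    ((forall x, B x = alpha * x) \/ (forall x, B x = alpha * cj x)).
Proof.
pose alpha := B 1; pose beta := B s; pose t := T (alpha * cj beta).
pose D := N beta - e%:Z * N alpha.
have Bsr r : B (s - r%:~R) = (- r)%:~R * alpha + beta.
  by rewrite -ZlinearE //; congr B; rewrite rmorphN mulNr mulr1 addrC.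
have NBsr r : N (B (s - r%:~R)) = N beta + r ^+ 2 * N alpha - r * t.
  by rewrite Bsr qr_normD qr_normZ -[_ * alpha * _]mulrA qr_traceZ -/t sqrrN; ring.
have [p [r [p_pr Mp pr p2r]]] := large_split_prime
  (12 * e.+1 ^ 2 + `|t| + `|2%:Z * D|) e_gt0.
have Mp' : (12 * e.+1 ^ 2 < p)%N by apply: leq_ltn_trans Mp; rewrite -addnA leq_addr.
have H1 := square_divides_norm p_pr Mp' pr p2r.
have H2 : (p%:Z ^+ 2 %| N (B (s - (- r)%:~R)))%Z.
  by apply: square_divides_norm; rewrite ?sqrrN // mulrN rpredN.
rewrite NBsr in H1; rewrite NBsr in H2.
have p2 : coprimez (p%:Z ^+ 2) (2%:Z * r) by rewrite coprimez_prime2.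
have zero (x : int) : (`|x| < p)%N -> (p%:Z ^+ 2 %| x)%Z -> x = 0.
  move=> xp px; apply/eqP; rewrite -absz_eq0; apply/negPn; rewrite -lt0n.
  apply/negP => x0; have := dvdz_sqr_weaken px; rewrite dvdzE => /(dvdn_leq x0).
  by rewrite leqNgt xp.
have t0 : t = 0.
  apply: zero.
    by apply: leq_ltn_trans Mp; rewrite addnAC leq_addl.
  rewrite -(Gauss_dvdzr _ p2).
  by apply: (@dvdz_comb _ _ _ (- 1) 1 _ H1 H2); rewrite sqrrN; ring.
have D0 : 2%:Z * D = 0.
  apply: zero; first by apply: leq_ltn_trans Mp; rewrite leq_addl.
  have H3 : (p%:Z ^+ 2 %| N beta + r ^+ 2 * N alpha)%Z.
    by move: H1; rewrite t0 mulr0 subr0.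
  by apply: (@dvdz_comb _ _ _ 2%:Z (- 2%:Z * N alpha) _ H3 pr); rewrite /D; ring.
have Nbeta : N beta = e%:Z * N alpha.
  by apply/eqP; rewrite -subr_eq0; move/eqP: D0; rewrite mulf_eq0.
have BE x : (2%:Z * e%:Z)%:~R * B x =
    (e%:Z * T x)%:~R * alpha + (- T (x * s))%:~R * beta.
  rewrite -ZlinearE0 // qr_coordinates -[(_ * T x)%:~R]mulr1.
  by rewrite ZlinearE // ZlinearE0 // mulr1.
have NB x : N (B x) = N alpha * N x.
  have e2 : (2%:Z * e%:Z) ^+ 2 != 0 by rewrite -PoszM -PoszX2 eqz_nat -lt0n expn_gt0 muln_gt0 e_gt0.
  apply: (mulfI e2); rewrite -qr_normZ BE qr_normD [cj (_ * beta)]rmorphM rmorph_int.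
  rewrite mulrACA -intrM qr_traceZ -/t t0 mulr0 addr0 !qr_normZ Nbeta.
  by rewrite [RHS]mulrCA -[(2%:Z * _) ^+ 2 * _]qr_normZ qr_coordinates qr_norm_comb /qform; ring.
(* Surjectivity of [B] enters through [B (A 1) = 1]: the nonnegative integer [N alpha] divides 1. *)
have Nalpha : N alpha = 1.
  have : N alpha * N (A 1) = 1.
    by rewrite -NB AK -[1]/(1%:~R) (qr_norm_int qR) expr1n.
  case: (N alpha) (qr_norm_ge0 qR alpha) => // m _.
  case: (N (A 1)) (qr_norm_ge0 qR (A 1)) => // n _.
  by rewrite -PoszM => -[] /eqP; rewrite muln_eq1 => /andP[/eqP ->].
exists alpha; split=> //; pose gamma := cj alpha * beta.
have agamma : alpha * gamma = beta.
  by rewrite /gamma mulrA -NE Nalpha mul1r.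
(* Dividing [B] by its value at 1 leaves an isometry fixing 1; it sends [s] to an element of trace 0
   and norm [e]. *)
have [] : gamma = s \/ gamma = - s.
- apply: qr_trace0_norm; first by rewrite /gamma -t0 /t -qr_traceC mulrC.
  by rewrite /gamma (qr_normM qR) (qr_normC qR) Nbeta Nalpha mulr1 mul1r.
- move=> gs; left => x; apply: (qr_mulfI qR two_e).
  by rewrite BE mulrCA qr_coordinates -agamma gs; ring.
move=> gs; right => x; apply: (qr_mulfI qR two_e).
have := congr1 cj (qr_coordinates x); rewrite [cj (_ * x)]rmorphM rmorph_int => H.
by rewrite BE mulrCA H [cj (_ + _)]rmorphD [cj (_ * s)]rmorphM !rmorph_int cj_s -agamma gs; ring.
Qed.

End SquareFreeStable.
End Stabiliser.

(** * Imaginary quadratic fields *)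

Lemma integral_rat (K : fieldExtType rat) (a : rat) :
  integralOver (intr : int -> K) a%:A -> exists k : int, a = k%:~R.
Proof.
case=> p p_monic p_root; pose q : {poly rat} := map_poly intr p.
have q_root : root q a.
  rewrite -(fmorph_root (in_alg K)) -map_poly_comp; apply: etrans p_root.
  by congr (root _ _); apply: eq_map_poly => k /=; rewrite scaler_int.
(* The claim is moved to the algebraic integers among the algebraic numbers, where the rational ones
   are known to be integers. *)
have : ratr a \in Aint.
  apply: (@root_monic_Aint (map_poly ratr q)); first by rewrite fmorph_root.
    by do 2!apply: monic_map.
  apply/polyOverP => i; rewrite !coef_map /= ratr_int; exact: rpred_int.
move/(Cint_rat_Aint (Crat_rat a)); rewrite Cint_rat => /intrP [k ->].
by exists k.
Qed.

(** * Restriction of field automorphisms to the ring of integers *)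

Section GaloisRestriction.
Variable K : splittingFieldType rat.
Local Notation O := (ringOfIntegers K).
Implicit Types (sigma : gal_of {:K}) (x y : O).

Lemma roi_val_inj : injective (@roi_val K).
Proof. exact: val_inj. Qed.

Lemma gal_restr_zmod sigma : zmod_morphism (gal_restr sigma).
Proof. by move=> x y; apply: roi_val_inj; rewrite /= !rmorphB. Qed.

Lemma gal_restr_monoid sigma : monoid_morphism (gal_restr sigma).
Proof. by split=> [|x y]; apply: roi_val_inj; rewrite /= ?rmorph1 ?rmorphM. Qed.

HB.instance Definition _ sigma := GRing.isZmodMorphism.Build O O
  (gal_restr sigma) (gal_restr_zmod sigma).
HB.instance Definition _ sigma := GRing.isMonoidMorphism.Build O O
  (gal_restr sigma) (gal_restr_monoid sigma).

Lemma roi_val_intr (k : int) : roi_val (k%:~R : O) = k%:~R.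
Proof. exact: (rmorph_int (val : O -> K)). Qed.

Lemma gal_restrM sigma sigma' : gal_restr (sigma * sigma')%g =
  gal_restr sigma' \o gal_restr sigma.
Proof.
by apply/funext => x; apply: roi_val_inj; rewrite /= galM ?memvf.
Qed.

Lemma gal_restr1 : gal_restr (1%g : gal_of {:K}) = id.
Proof. by apply/funext => x; apply: roi_val_inj; rewrite /= gal_id. Qed.

Lemma gal_restrK sigma : cancel (gal_restr sigma) (gal_restr sigma^-1%g).
Proof.
by move=> x; have := congr1 (@^~ x) (gal_restrM sigma sigma^-1%g);
  rewrite mulgV gal_restr1.
Qed.

Lemma gal_restrVK sigma : cancel (gal_restr sigma^-1%g) (gal_restr sigma).
Proof. by have := gal_restrK sigma^-1%g; rewrite invgK. Qed.

End GaloisRestriction.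

Section ImaginaryQuadratic.
Variables (d : int) (K : splittingFieldType rat) (s : K).
Hypotheses (d_lt0 : d < 0) (d_sqf : squarefree_int d).
Hypotheses (s_sqr : s ^+ 2 = d%:~R) (s_gen : <<1; s>>%VS = fullv).
Local Notation O := (ringOfIntegers K).

Lemma quadratic_coord (x : K) : exists a b : rat, x = a%:A + b *: s.
Proof.
have : x \in <<1; s>>%VS by rewrite s_gen memvf.
case/Fadjoin_polyP => p /polyOver1P [q ->] ->; elim/poly_ind: q => [|q c [a [b E]]].
  by exists 0, 0; rewrite rmorph0 horner0 !scale0r addr0.
exists (b * d%:~R + c), a; rewrite rmorphD rmorphM /= map_polyX map_polyC /=.
have bss : b *: s * s = (b * d%:~R)%:A.
  by rewrite -(mulr_algl b s) -mulrA -expr2 s_sqr -(scaler_int d) mulr_algl scalerA.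
by rewrite !hornerE E mulrDl bss mulr_algl scalerDl -addrA addrC.
Qed.

Lemma in_alg_inj (a b : rat) : a%:A = b%:A :> K -> a = b.
Proof. exact: (fmorph_inj (in_alg K)). Qed.

Lemma sqrt_irrational (a : rat) : s != a%:A.
Proof.
apply/eqP => sE; have : (a ^+ 2)%:A = (d%:~R : rat)%:A :> K.
  by rewrite scaler_int -s_sqr sE; apply: (rmorphXn (in_alg K) 2 a).
move/in_alg_inj => a2; have := sqr_ge0 a; rewrite a2 ler0z leNgt d_lt0 //.
Qed.

Lemma sqrt_neq0 : s != 0.
Proof. by have := sqrt_irrational 0; rewrite scale0r. Qed.

Lemma gal_coord (sigma : gal_of {:K}) (a b : rat) :
  sigma (a%:A + b *: s) = a%:A + b *: sigma s.
Proof. by rewrite linearD !linearZ /= rmorph1. Qed.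

Lemma gal_sqrt (sigma : gal_of {:K}) : sigma s = s \/ sigma s = - s.
Proof.
have /eqP : (sigma s) ^+ 2 = s ^+ 2 by rewrite -rmorphXn /= s_sqr rmorph_int.
by rewrite eqf_sqr => /orP[] /eqP; [left|right].
Qed.

Lemma gal_ext (sigma sigma' : gal_of {:K}) : sigma s = sigma' s -> sigma = sigma'.
Proof.
move=> E; apply/eqP/gal_eqP => x _; have [a [b ->]] := quadratic_coord x.
by rewrite !gal_coord E.
Qed.

(** Otherwise [s] would be fixed by the whole Galois group, hence rational. *)
Lemma gal_conj_exists :
  exists2 sigma : gal_of {:K}, sigma \in ('Gal({:K} / 1))%g & sigma s = - s.
Proof.
apply: contrapT => none.
have galK1 : galois 1 {:K}.
  rewrite /galois sub1v normalFieldf andbT; apply/separableP => y _.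
  by apply: pcharf0_separable => p; rewrite pchar_lalg pchar_num.
have : s \in fixedField ('Gal({:K} / 1))%g.
  apply/fixedFieldP => [|sigma sigmaG]; first exact: memvf.
  by have [//|ts] := gal_sqrt sigma; case: none; exists sigma.
have /galois_fixedField -> := galK1.
by case/vlineP => a sE; have /eqP := sqrt_irrational a.
Qed.

Definition gal_conj : gal_of {:K} :=
  xget 1%g [set sigma | sigma \in ('Gal({:K} / 1))%g /\ sigma s = - s].

Lemma gal_conjP : gal_conj \in ('Gal({:K} / 1))%g /\ gal_conj s = - s.
Proof.
rewrite /gal_conj; case: xgetP => [t _ []//|none]; have [t tG ts] := gal_conj_exists.
by case: (none t).
Qed.

Lemma gal_cases (sigma : gal_of {:K}) : sigma = 1%g \/ sigma = gal_conj.
Proof.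
have [E|E] := gal_sqrt sigma; [left|right]; apply: gal_ext; rewrite E ?gal_id //.
by case: gal_conjP.
Qed.

Lemma gal_conj_neq1 : gal_conj != 1%g.
Proof.
apply/eqP => E; have [_] := gal_conjP; rewrite E gal_id => /eqP.
rewrite -addr_eq0 -mulr2n -scaler_nat scaler_eq0 (negbTE sqrt_neq0) orbF.
by rewrite pnatr_eq0.
Qed.

Lemma gal_conjM : (gal_conj * gal_conj = 1)%g.
Proof.
apply: gal_ext; have [_ E] := gal_conjP.
by rewrite galM ?memvf // E rmorphN /= E opprK gal_id.
Qed.

Lemma gal_conjV : gal_conj^-1%g = gal_conj.
Proof. by apply/eqP; rewrite eq_invg_mul gal_conjM. Qed.

Definition roi_conj : {rmorphism O -> O} := gal_restr gal_conj.

Lemma roi_conjK : involutive roi_conj.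
Proof. by move=> x; rewrite /roi_conj /=; have := gal_restrK gal_conj x; rewrite gal_conjV. Qed.

(** Makes norms and traces rational integers. *)
Lemma roi_conj_fixed (x : O) : roi_conj x = x -> exists k : int, x = k%:~R.
Proof.
move=> /(congr1 (@roi_val K)) /=; have [a [b xE]] := quadratic_coord (roi_val x).
rewrite xE gal_coord gal_conjP.2 scalerN => /addrI/eqP.
rewrite -subr_eq0 -opprD oppr_eq0 -scalerDl scaler_eq0 (negbTE sqrt_neq0) orbF.
rewrite -mulr2n mulrn_eq0 /= => /eqP b0; rewrite b0 scale0r addr0 in xE.
have /asboolP := roi_valP x; rewrite xE => /integral_rat [k aE].
by exists k; apply: roi_val_inj; rewrite roi_val_intr xE aE scaler_int.
Qed.

Lemma norm_exists (x : O) : exists k : int, k%:~R = x * roi_conj x.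
Proof.
by have [|k ->] := @roi_conj_fixed (x * roi_conj x); [rewrite rmorphM roi_conjK mulrC|exists k].
Qed.

Lemma trace_exists (x : O) : exists k : int, k%:~R = x + roi_conj x.
Proof.
by have [|k ->] := @roi_conj_fixed (x + roi_conj x); [rewrite rmorphD roi_conjK addrC|exists k].
Qed.

Definition roi_norm (x : O) : int := projT1 (cid (norm_exists x)).
Definition roi_trace (x : O) : int := projT1 (cid (trace_exists x)).

Lemma roi_intr_inj : injective (intr : int -> O).
Proof.
move=> k l /(congr1 (@roi_val K)); rewrite !roi_val_intr.
rewrite -!(scaler_int _ (1 : K)) => /in_alg_inj; exact: intr_inj.
Qed.

Lemma roi_quadratic : quadratic_ring roi_conj roi_norm roi_trace.
Proof.
have NE x : (roi_norm x)%:~R = x * roi_conj x by rewrite /roi_norm; case: cid.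
have TE x : (roi_trace x)%:~R = x + roi_conj x by rewrite /roi_trace; case: cid.
split=> //; [exact: roi_conjK|exact: roi_intr_inj|move=> x x0|move=> g x g0].
  have := congr1 (@roi_val K) (NE x); rewrite roi_val_intr /=.
  have [a [b xE]] := quadratic_coord (roi_val x).
  have x0' : (a != 0) || (b != 0).
    rewrite -negb_and; apply: contra x0 => /andP[/eqP a0 /eqP b0].
    by apply/eqP/roi_val_inj; rewrite xE a0 b0 !scale0r addr0.
  rewrite xE gal_coord gal_conjP.2 => H.
  have {}H : (roi_norm x)%:~R = a ^+ 2 - d%:~R * b ^+ 2 :> rat.
    apply: in_alg_inj; rewrite scaler_int H scalerN mulrC -subr_sqr.
    rewrite exprZn expr1n exprZn s_sqr -(scaler_int d) scalerA -scalerBl.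
    by rewrite [d%:~R * _]mulrC.
  rewrite -(ltr0z rat) H -mulNr; have d0 : 0 < - d%:~R :> rat by rewrite oppr_gt0 ltrz0.
  case/orP: x0' => h.
    by rewrite ltr_wpDr ?exprn_even_gt0 // mulr_ge0 ?sqr_ge0 // ltW.
  by rewrite ltr_wpDl ?sqr_ge0 // mulr_gt0 // exprn_even_gt0.
move=> /dvdzP [n nE] /dvdzP [t tE].
have gK : (g%:~R : K) != 0.
  by apply: contraNneq g0 => /eqP; rewrite -roi_val_intr => /eqP h; apply/eqP/roi_intr_inj/roi_val_inj.
(* With [t] and [n] the quotients of trace and norm by [g] and [g ^ 2], the element [x / g] is a
   root of [X ^ 2 - t * X + n], so it belongs to the ring of integers. *)
have yI : roi_val x / g%:~R \in @is_integral K.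
  apply/asboolP; exists (('X - t%:P) * 'X + n%:P).
    apply/monicP; rewrite lead_coefDl; first by apply/monicP; rewrite monicMr ?monicX ?monicXsubC.
    rewrite size_mulX ?polyXsubC_eq0 // size_XsubC.
    exact: leq_ltn_trans (size_polyC_leq1 _) _.
  rewrite /root rmorphD rmorphM rmorphB /= !map_polyC map_polyX /=.
  rewrite hornerD hornerMX hornerXsubC hornerC.
  have := congr1 (@roi_val K) (NE x); have := congr1 (@roi_val K) (TE x).
  rewrite !roi_val_intr nE tE !intrM /= => H1 H2.
  have xE : roi_val x = roi_val x / g%:~R * g%:~R by rewrite divfK.
  move: (roi_val x / g%:~R) xE => y xE; apply/eqP.
  apply: (mulIf (expf_neq0 2 gK)); rewrite mul0r mulrDl.
  have -> : n%:~R * g%:~R ^+ 2 = roi_val x * gal_conj (roi_val x) by rewrite -H2.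
  have -> : (y - t%:~R) * y * g%:~R ^+ 2 = (y * g%:~R - t%:~R * g%:~R) * (y * g%:~R).
    by ring.
  by rewrite -xE H1; ring.
exists (RingOfIntegers yI); apply: roi_val_inj.
by rewrite /= roi_val_intr mulrCA mulfV ?mulr1.
Qed.

End ImaginaryQuadratic.

(** A prime whose square contains [f x] pulls back along [f] to a prime whose square contains
    [x]. *)
Lemma square_free_automorphism (R : comNzRingType) (cj : {rmorphism R -> R})
    (N T : R -> int) (f g : {rmorphism R -> R}) (x : R) :
    quadratic_ring cj N T -> cancel f g -> cancel g f ->
  square_free x -> square_free (f x).
Proof.
move=> qR fK gK /(square_freeP qR) [x0 xP]; apply/(square_freeP qR); split.
  by apply: contra x0 => /eqP fx; rewrite -[x]fK fx rmorph0.
move=> P /prime_idealP [[P0 PD] P1 PM] [n [a [b [Pa Pb fxE]]]].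
apply: (xP (f @^-1` P)).
  apply/prime_idealP; split=> /=; [split=> /=| |].
  - by rewrite rmorph0.
  - by move=> c y z Py Pz; rewrite rmorphD rmorphM; apply: PD.
  - by rewrite rmorph1.
  by move=> y z; rewrite rmorphM; apply: PM.
exists n, (g \o a), (g \o b); split=> [i|i|] /=; rewrite ?gK //.
by rewrite -[x]fK fxE rmorph_sum; apply: eq_bigr => i _; rewrite rmorphM.
Qed.

Lemma square_free_unit (R : comNzRingType) (cj : {rmorphism R -> R})
    (N T : R -> int) (u v x : R) :
    quadratic_ring cj N T -> u * v = 1 -> square_free x -> square_free (u * x).
Proof.
move=> qR uv /(square_freeP qR) [x0 xP]; apply/(square_freeP qR).
have xE : x = v * (u * x) by rewrite mulrA [v * u]mulrC uv mul1r.
split=> [|P pP uxP]; first by apply: contra x0 => /eqP ux; rewrite xE ux mulr0.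
apply: (xP P pP); rewrite xE; apply: is_idealM => //; apply: ideal_mul_ideal.
by case/prime_idealP: pP.
Qed.

(** * Units of an imaginary quadratic ring *)

Section UnitGroup.
Variables (R : comNzRingType) (cj : {rmorphism R -> R}) (N T : R -> int).
Hypothesis qR : quadratic_ring cj N T.
Variables (e : nat) (s : R).
Hypotheses (e_gt0 : (0 < e)%N) (s_sqr : s * s = - e%:Z%:~R) (cj_s : cj s = - s).
Hypothesis e_sqf : forall m : int, (m ^+ 2 %| e%:Z)%Z -> `|m|%N = 1%N.

Let TE := qr_traceE qR.
Let NE := qr_normE qR.

Let T1 : T 1 = 2.
Proof. by rewrite -[1]/(1%:~R) (qr_trace_int qR). Qed.

Let TN x : T (- x) = - T x.
Proof. by rewrite -mulN1r -[-1]/((-1)%:~R) (qr_traceZ qR) mulN1r. Qed.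

Let Ts : T s = 0.
Proof. by apply: (qr_intr_inj qR); rewrite TE cj_s subrr. Qed.

Let two_inj : injective ( *%R (2%:Z%:~R : R)).
Proof. by apply: (qr_mulfI qR); apply: (intr_neq0 qR). Qed.

Lemma unit_norm (x y : R) : x * y = 1 -> N x = 1.
Proof.
move=> xy; have := congr1 N xy; rewrite (qr_normM qR) -[1 in RHS]/(1%:~R).
rewrite (qr_norm_int qR) expr1n.
case: (N x) (qr_norm_ge0 qR x) => // m _; case: (N y) (qr_norm_ge0 qR y) => // n _.
by rewrite -PoszM => -[] /eqP; rewrite muln_eq1 => /andP[/eqP ->].
Qed.

Lemma unit_cases (x : R) : N x = 1 ->
  [\/ x = 1 \/ x = - 1, e = 1%N /\ (x = s \/ x = - s) |
      e = 3%N /\ exists2 a : int, a = 1 \/ a = -1 &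
        2%:Z%:~R * x = a%:~R + s \/ 2%:Z%:~R * x = a%:~R - s].
Proof.
move=> Nx; have xE := qr_coordinates qR s_sqr cj_s x.
have := congr1 N xE; rewrite (qr_normZ qR) (qr_norm_comb qR s_sqr cj_s) Nx /qform.
move: (T x) (- T (x * s)) xE => t V xE VE.
(* This equation bounds [t] by 2. For [t = 1] or [-1] it gives [e = 3 * W ^ 2], for [t = 0] it gives
   [e = W ^ 2], and square-freeness of [e] settles both. *)
have {}VE : V ^+ 2 = e%:Z * (4%:Z - t ^+ 2).
  have e0 : e%:Z != 0 by rewrite eqz_nat -lt0n.
  apply: (mulfI e0); apply: (addrI (e%:Z ^+ 2 * t ^+ 2)).
  by rewrite -exprMn -VE; ring.
have t_cases : [\/ t = 2 \/ t = -2, t = 1 \/ t = -1 | t = 0].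
  have : 0 <= e%:Z * (4%:Z - t ^+ 2) by rewrite -VE sqr_ge0.
  rewrite pmulr_rge0 // subr_ge0 => t4; have : -2 <= t /\ t <= 2 by clear -t4; nia.
  move=> t2; have : t = 2 \/ t = -2 \/ t = 1 \/ t = -1 \/ t = 0 by clear -t2; lia.
  by case=> [|[|[|[|]]]] ->; [constructor 1; left|constructor 1; right|
    constructor 2; left|constructor 2; right|constructor 3].
have cancel_e (y : R) : (2%:Z * e%:Z)%:~R * x = (2%:Z * e%:Z)%:~R * y -> x = y.
  by apply: (qr_mulfI qR); apply: (intr_neq0 qR); rewrite muln_gt0.
have sqr1 (W : int) : `|W|%N = 1%N -> W = 1 \/ W = -1 by clear; lia.
case: t_cases => [t2|t1|t0].
- constructor 1; have V0 : V = 0.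
    apply/eqP; rewrite -sqrf_eq0 VE; case: t2 => ->; by rewrite ?sqrrN mulr0.
  by case: t2 xE => -> xE; [left|right]; apply: cancel_e; rewrite xE V0 !intrM; ring.
- have V3 : V ^+ 2 = 3%:Z * e%:Z by rewrite VE mulrC; case: t1 => ->; rewrite ?sqrrN.
  have /dvdzP [W WE] : (3 %| V)%Z.
    by rewrite -(@prime_dvdzX2 3) // V3; apply: dvdz_mulr.
  have eW : e%:Z = 3%:Z * W ^+ 2.
    by apply: (@mulfI _ 3%:Z) => //; rewrite -V3 WE; ring.
  have W1 : W = 1 \/ W = -1 by apply/sqr1/e_sqf; rewrite eW dvdz_mull.
  have e3 : e = 3%N by move: eW; case: W1 => ->; rewrite ?sqrrN expr1n mulr1 => -[].
  constructor 3; split=> //; exists t => //.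
  have three (y : R) : 2%:Z%:~R * x * 3%:Z%:~R = y * 3%:Z%:~R -> 2%:Z%:~R * x = y.
    rewrite ![_ * 3%:Z%:~R]mulrC; apply: (qr_mulfI qR); exact: (intr_neq0 qR).
  rewrite e3 WE in xE.
  by case: W1 xE => -> xE; [left|right]; apply: three; move: xE; rewrite !intrM => xE;
    rewrite mulrAC xE; ring.
have V4 : V ^+ 2 = 4%:Z * e%:Z by rewrite VE t0 expr0n subr0 mulrC.
have /dvdzP [W WE] : (2 %| V)%Z.
  by rewrite -(@prime_dvdzX2 2) // V4 (_ : 4%:Z = 2%:Z * 2%:Z) // -mulrA; apply: dvdz_mulr.
have eW : e%:Z = W ^+ 2.
  by apply: (@mulfI _ 4%:Z) => //; rewrite -V4 WE; ring.
have W1 : W = 1 \/ W = -1 by apply/sqr1/e_sqf; rewrite eW.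
have e1 : e = 1%N by move: eW; case: W1 => ->; rewrite ?sqrrN expr1n => -[].
constructor 2; split=> //; rewrite t0 WE e1 in xE.
by case: W1 xE => -> xE; [left|right]; apply: cancel_e; rewrite e1 xE !intrM; ring.
Qed.

Definition unit_order : nat :=
  if e == 1%N then 4%N else if e == 3%N then 6%N else 2%N.

Lemma unit_generator : exists z : R,
  [/\ z * cj z = 1, z ^+ unit_order = 1,
      forall k, (0 < k < unit_order)%N -> z ^+ k != 1
    & forall x, N x = 1 -> exists k, x = z ^+ k].
Proof.
(* Proper powers of the generator are told from 1 by their traces. *)
have no1 (x : R) : T x != 2 -> x != 1 by apply: contraNneq => ->; rewrite T1.
rewrite /unit_order; have [e1|e1] := eqVneq e 1%N.
  have s2 : s ^+ 2 = -1 by rewrite expr2 s_sqr e1.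
  have s3 : s ^+ 3 = - s by rewrite exprSr s2 mulN1r.
  exists s; split.
  - by rewrite cj_s mulrN s_sqr opprK e1.
  - by rewrite (exprM s 2 2) s2 sqrrN expr1n.
  - case=> [//|[|[|[|//]]]] _; apply: no1; rewrite ?expr1 ?s2 ?s3 ?TN ?T1 ?Ts //.
  move=> x /unit_cases [[] ->|[_ [] ->]|[e3]]; last by rewrite e3 in e1.
  - by exists 0.
  - by exists 2%N; rewrite s2.
  - by exists 1%N.
  by exists 3%N; rewrite s3.
have [e3|e3] := eqVneq e 3%N; last first.
  exists (-1); split.
  - by rewrite rmorphN rmorph1 mulrNN mulr1.
  - by rewrite sqrrN expr1n.
  - by case=> [//|[|//]] _; apply: no1; rewrite expr1 TN T1.
  move=> x /unit_cases [[] ->|[e1']|[e3']].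
  - by exists 0.
  - by exists 1%N.
  - by rewrite e1' in e1.
  by rewrite e3' in e3.
(* [1 + s] has norm 4 and trace 2, so it is divisible by 2; the quotient [w] is a primitive sixth
   root of unity. *)
have [w wE] : exists w, 1 + s = 2%:Z%:~R * w.
  apply: (qr_div qR) => //.
    rewrite -[1]/(1%:~R) -[s]mul1r -[1 in X in _ + X]/(1%:~R).
    by rewrite (qr_norm_comb qR s_sqr cj_s) /qform e3.
  by rewrite (qr_traceD qR) T1 Ts.
have wN : N w = 1.
  have := congr1 N wE; rewrite (qr_normZ qR).
  rewrite -[1 in LHS]/(1%:~R) -[s]mul1r -[1 in X in _ + X]/(1%:~R).
  by rewrite (qr_norm_comb qR s_sqr cj_s) /qform e3; lia.
have wT : T w = 1.
  by have := congr1 T wE; rewrite (qr_traceZ qR) (qr_traceD qR) T1 Ts; lia.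
have wcj : w * cj w = 1 by rewrite -NE wN.
have w2 : w ^+ 2 = w - 1.
  have : w + cj w = 1 by rewrite -TE wT.
  by move/(congr1 (fun t => t - w)); rewrite addrC addKr => cw; rewrite -wcj cw; ring.
have w3 : w ^+ 3 = -1 by rewrite exprSr w2 mulrBl mul1r -expr2 w2; ring.
have w4 : w ^+ 4 = - w by rewrite exprSr w3 mulN1r.
have w5 : w ^+ 5 = 1 - w by rewrite exprSr w4 mulNr -expr2 w2 opprB.
exists w; split=> //.
- by rewrite (exprM w 3 2) w3 sqrrN expr1n.
- case=> [//|[|[|[|[|[|//]]]]]] _; apply: no1;
    rewrite ?expr1 ?w2 ?w3 ?w4 ?w5 ?(qr_traceD qR) ?TN ?T1 ?wT //.
have sE : s = 2%:Z%:~R * w - 1 by rewrite -wE addrC addKr.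
move=> x /unit_cases [[] ->|[e1']|[_ [a aE] xE]].
- by exists 0.
- by exists 3%N; rewrite w3.
- by rewrite e1' in e1.
have {}xE : [\/ x = w, x = - w, x = w - 1 | x = 1 - w].
  have two (y : R) : 2%:Z%:~R * x = 2%:Z%:~R * y -> x = y by apply: two_inj.
  case: aE xE => -> [] xE.
  - by constructor 1; apply: two; rewrite xE sE; ring.
  - by constructor 4; apply: two; rewrite xE sE; ring.
  - by constructor 3; apply: two; rewrite xE sE; ring.
  - by constructor 2; apply: two; rewrite xE sE; ring.
case: xE => ->; [by exists 1%N|by exists 4%N|by exists 2%N|by exists 5%N].
Qed.

End UnitGroup.

(** * The stabiliser *)

Section StabiliserGroup.
Variables (d : int) (K : splittingFieldType rat) (s : K).
Hypotheses (d_lt0 : d < 0) (d_sqf : squarefree_int d).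
Hypotheses (s_sqr : s ^+ 2 = d%:~R) (s_gen : <<1; s>>%VS = fullv).
Local Notation O := (ringOfIntegers K).
Local Notation V := (@square_free O).
Local Notation tau := (gal_conj s).
Local Notation cj := (roi_conj s).
Implicit Types (eps : O) (sigma : gal_of {:K}).

Let qR := roi_quadratic d_lt0 s_sqr s_gen.
Let e := `|d|%N.

Let e_gt0 : (0 < e)%N. Proof. by rewrite absz_gt0 lt_eqF. Qed.

Let dE : d = - e%:Z. Proof. by rewrite /e abszE ltr0_norm ?opprK. Qed.

Fact s_integral : s \in @is_integral K.
Proof.
apply/asboolP; exists ('X * 'X - d%:P).
  apply/monicP; rewrite lead_coefDl; first by apply/monicP; rewrite monicMr ?monicX.
  by rewrite size_mulX ?polyX_eq0 // size_polyX size_polyN (leq_ltn_trans (size_polyC_leq1 _)).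
rewrite /root rmorphB rmorphM /= map_polyX map_polyC /= hornerD hornerN hornerMX.
by rewrite hornerX hornerC -expr2 s_sqr subrr.
Qed.

Let sO : O := RingOfIntegers s_integral.

Let sO_sqr : sO * sO = - e%:Z%:~R.
Proof.
apply: roi_val_inj; rewrite -rmorphN -dE roi_val_intr /=.
by rewrite -expr2.
Qed.

Let cj_sO : cj sO = - sO.
Proof. by apply: roi_val_inj; rewrite /= (gal_conjP d_lt0 s_sqr).2. Qed.

Let sO_neqN : sO <> - sO.
Proof.
move=> /eqP; rewrite -addr_eq0 => /eqP /(congr1 (fun x => x * sO)).
by rewrite mulrDl mul0r sO_sqr -opprD -rmorphD -rmorphN => /(@roi_intr_inj _ _ 0); lia.
Qed.

Lemma unit_normP eps : eps \is a GRing.unit <-> roi_norm d_lt0 s_sqr s_gen eps = 1.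
Proof.
split=> [epsU|Neps]; first exact: (unit_norm qR (mulrV epsU)).
by apply/unitrP; exists (cj eps); rewrite mulrC -(qr_normE qR) Neps.
Qed.

Lemma mem_gal sigma : sigma \in ('Gal({:K} / 1))%g.
Proof.
by case: (gal_cases d_lt0 s_sqr s_gen sigma) => ->; [exact: group1|case: (gal_conjP d_lt0 s_sqr)].
Qed.

Lemma unit_mul_comp eps eps' : unit_mul eps \o unit_mul eps' = unit_mul (eps * eps').
Proof. by apply/funext => x; rewrite /unit_mul /= mulrA. Qed.

Lemma gal_unit_mul sigma eps :
  gal_restr sigma \o unit_mul eps = unit_mul (gal_restr sigma eps) \o gal_restr sigma.
Proof. by apply/funext => x; rewrite /unit_mul /= rmorphM. Qed.

Lemma square_free_map eps sigma x :
  eps \is a GRing.unit -> V x -> V (unit_mul eps (gal_restr sigma x)).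
Proof.
move=> epsU Vx; apply: (square_free_unit qR (mulrV epsU)).
exact: (square_free_automorphism qR (gal_restrK sigma) (gal_restrVK sigma)).
Qed.

Lemma unit_gal_cancel eps sigma : eps \is a GRing.unit ->
  cancel (unit_mul eps \o gal_restr sigma)
    (unit_mul (gal_restr sigma^-1%g eps^-1) \o gal_restr sigma^-1%g).
Proof.
by move=> epsU x; rewrite /unit_mul /= -rmorphM mulKr //; apply: gal_restrK.
Qed.

Lemma unit_gal_cancelV eps sigma : eps \is a GRing.unit ->
  cancel (unit_mul (gal_restr sigma^-1%g eps^-1) \o gal_restr sigma^-1%g)
    (unit_mul eps \o gal_restr sigma).
Proof.
move=> epsU x; rewrite /unit_mul /= -rmorphM.
by have -> := gal_restrVK sigma (eps^-1 * x); rewrite mulVKr.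
Qed.

Lemma unit_gal_inv_unit eps sigma : eps \is a GRing.unit ->
  gal_restr sigma^-1%g eps^-1 \is a GRing.unit.
Proof. by move=> epsU; rewrite rmorph_unit // unitrV. Qed.

Lemma Zlinear_unit_gal eps sigma : Zlinear (unit_mul eps \o gal_restr sigma).
Proof.
by move=> k x y; rewrite /unit_mul /= rmorphD rmorphMz mulrDr mulrzAr.
Qed.

Lemma stabP (A : O -> O) : stab V A <->
  exists eps sigma, eps \is a GRing.unit /\ A = unit_mul eps \o gal_restr sigma.
Proof.
split=> [[A_lin [B AK BK] AV]|[eps [sigma [epsU ->]]]]; last first.
  split; [exact: Zlinear_unit_gal| |by move=> _ [x Vx <-]; apply: square_free_map].
  exact: Bijective (unit_gal_cancel sigma epsU) (unit_gal_cancelV sigma epsU).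
have B_lin : Zlinear B.
  by move=> k x y; apply: (can_inj AK); rewrite BK A_lin !BK.
have [alpha [Na]] := square_free_stable_inverse qR e_gt0 sO_sqr cj_sO A_lin B_lin AK BK AV.
have aU : alpha \is a GRing.unit by apply/unit_normP.
have aca : alpha * cj alpha = 1 by rewrite -(qr_normE qR) Na.
(* As [alpha * cj alpha = 1], the map [alpha * cj x] is an involution, so [A = B] in that case; in
   the other, the inverse of multiplication by [alpha] is multiplication by [cj alpha]. *)
case=> BE; last first.
  exists alpha, tau; split=> //; apply/funext => x; rewrite -[x in RHS]AK BE.
  by rewrite /unit_mul /= -/(cj _) rmorphM (qr_conjK qR) mulrA aca mul1r.
exists (cj alpha), 1%g; split; first by rewrite rmorph_unit.
apply/funext => x; rewrite gal_restr1 /unit_mul /= -[x in RHS]AK BE.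
by rewrite mulrA [cj _ * _]mulrC aca mul1r.
Qed.

Lemma comp_group_stab : comp_group (stab V).
Proof.
split=> [|A B|A].
- apply/stabP; exists 1, 1%g; rewrite unitr1; split=> //.
  by apply/funext => x; rewrite gal_restr1 /unit_mul /= mul1r.
- move=> /stabP [a [sigma [aU ->]]] /stabP [b [sigma' [bU ->]]].
  apply/stabP; exists (a * gal_restr sigma b), (sigma' * sigma)%g.
  rewrite unitrM aU rmorph_unit //; split=> //; apply/funext => x.
  by rewrite gal_restrM /unit_mul /= rmorphM mulrA.
move=> /stabP [a [sigma [aU ->]]].
exists (unit_mul (gal_restr sigma^-1%g a^-1) \o gal_restr sigma^-1%g).
split; [apply/stabP|exact: unit_gal_cancel|exact: unit_gal_cancelV].
by exists (gal_restr sigma^-1%g a^-1), sigma^-1%g; rewrite unit_gal_inv_unit.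
Qed.

Lemma comp_group_units : comp_group (@unit_maps K).
Proof.
split=> [|_ _ [a aU <-] [b bU <-]|_ [a aU <-]].
- by exists 1; [exact: unitr1|apply/funext => x; rewrite /unit_mul mul1r].
- by exists (a * b); rewrite ?unit_mul_comp //=; rewrite unitrM; apply/andP.
exists (unit_mul a^-1); split; first by exists a^-1; rewrite //= unitrV.
  by move=> x; rewrite /unit_mul mulKr.
by move=> x; rewrite /unit_mul mulVKr.
Qed.

Lemma comp_group_gal : comp_group (@gal_maps K).
Proof.
split=> [|_ _ [sigma _ <-] [sigma' _ <-]|_ [sigma _ <-]].
- by exists 1%g; [exact: mem_gal|exact: gal_restr1].
- by exists (sigma' * sigma)%g; [exact: mem_gal|rewrite gal_restrM].
exists (gal_restr sigma^-1%g); split; first by exists sigma^-1%g; first exact: mem_gal.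
  exact: gal_restrK.
exact: gal_restrVK.
Qed.

Lemma stab_sdprod : comp_sdprod (@unit_maps K) (@gal_maps K) (stab V).
Proof.
split.
- by split; [exact: comp_group_stab|exact: comp_group_units|exact: comp_group_gal].
- split=> _ [x xP <-]; apply/stabP.
    by exists x, 1%g; rewrite gal_restr1.
  exists 1, x; rewrite unitr1; split=> //.
  by apply/funext => y; rewrite /unit_mul /= mul1r.
- move=> _ B _ /stabP [a [sigma [aU ->]]] AK BK [c cU <-].
  exists (gal_restr sigma c); first exact: rmorph_unit.
  apply/funext => x; rewrite /unit_mul /= rmorphM mulrCA; congr (_ * _).
  exact: esym (BK x).
- apply/seteqP; split=> [_ [[a aU <-] [sigma _ E]]|_ ->]; last first.
    by split; [case: comp_group_units|case: comp_group_gal].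
  (* Automorphisms fix 1, so evaluating at 1 shows that the unit is 1. *)
  apply/funext => x; rewrite /unit_mul.
  by have := congr1 (@^~ 1) E; rewrite /unit_mul rmorph1 mulr1 => <-; rewrite mul1r.
apply/seteqP; split=> [A /stabP [a [sigma [aU ->]]]|_ [_ [a aU <-] [_ [sigma _ <-] <-]]].
  exists (unit_mul a); first by exists a.
  by exists (gal_restr sigma) => //; exists sigma; first exact: mem_gal.
by apply/stabP; exists a, sigma.
Qed.

Lemma gal_isog : ('Gal({:K} / 1) \isog Zp 2)%g.
Proof.
have tau1 := gal_conj_neq1 d_lt0 s_sqr.
have tau2 : #[tau]%g = 2%N.
  apply: nt_prime_order => //; rewrite expgS expg1; exact: (gal_conjM d_lt0 s_sqr s_gen).
have -> : ('Gal({:K} / 1) = <[tau]>)%g.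
  apply/setP => sigma; rewrite mem_gal.
  by case: (gal_cases d_lt0 s_sqr s_gen sigma) => ->; rewrite ?group1 ?cycle_id.
by rewrite isog_sym; have := Zp_isog tau; rewrite tau2.
Qed.

Lemma iter_unit_mul eps k : iter k (unit_mul eps) = unit_mul (eps ^+ k).
Proof.
elim: k => [|k IHk]; apply/funext => x; first by rewrite /unit_mul expr0 mul1r.
by rewrite iterS IHk /unit_mul exprS mulrA.
Qed.

Lemma gal_maps_isog : comp_isog (@gal_maps K) 'Z_2.
Proof.
have cj2 : iter 2 cj =1 id by move=> x; apply: (qr_conjK qR).
apply: (@comp_isog_cyclic _ cj 2) => //.
  apply/seteqP; split=> [_ [sigma _ <-]|_ [k _ <-]].
    case: (gal_cases d_lt0 s_sqr s_gen sigma) => ->; last by exists 1%N.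
    by exists 0 => //; rewrite gal_restr1.
  rewrite -(iter_modn cj2) modn2; case: (odd k); first by exists tau; first exact: mem_gal.
  by exists 1%g; [exact: mem_gal|exact: gal_restr1].
by case=> [|[|//]] [|[|//]] // _ _ /(congr1 (@^~ sO)) /=; rewrite cj_sO => h; case: sO_neqN.
Qed.

Let e_sqf (m : int) : (m ^+ 2 %| e%:Z)%Z -> `|m|%N = 1%N.
Proof. by move=> me; apply: d_sqf; rewrite dE rpredN. Qed.

Lemma unit_order_gt1 : (1 < unit_order e)%N.
Proof. by rewrite /unit_order; do 2?case: ifP. Qed.

Lemma unit_maps_generator : exists z : O,
  [/\ z * cj z = 1, z ^+ unit_order e = 1,
      forall i j, (i < unit_order e)%N -> (j < unit_order e)%N -> z ^+ i = z ^+ j -> i = j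
    & forall eps, eps \is a GRing.unit <-> exists k, eps = z ^+ k].
Proof.
have [z [zcj zn z_neq z_gen]] := unit_generator qR e_gt0 sO_sqr cj_sO e_sqf.
have zU : z \is a GRing.unit by apply/unitrP; exists (cj z); rewrite mulrC.
exists z; split=> //; last first.
  move=> eps; split=> [/unit_normP/z_gen//|[k ->]]; exact: unitrX.
have z_lt i j : (i < j)%N -> (j < unit_order e)%N -> z ^+ i <> z ^+ j.
  move=> ij jn zij; have : z ^+ (j - i) != 1.
    by apply: z_neq; rewrite subn_gt0 ij (leq_ltn_trans (leq_subr _ _)).
  by case/eqP; apply: (mulrI (unitrX i zU)); rewrite -exprD subnKC ?(ltnW ij) // mulr1.
by move=> i j ni nj zij; case: (ltngtP i j) => // /z_lt; [move/(_ nj)|move/(_ ni)] => [] [].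
Qed.

Lemma unit_maps_isog : comp_isog (@unit_maps K) 'Z_(unit_order e).
Proof.
have [z [zcj zn z_inj z_gen]] := unit_maps_generator.
apply: (@comp_isog_cyclic _ (unit_mul z) _ unit_order_gt1).
- by move=> x; rewrite iter_unit_mul zn /unit_mul mul1r.
- apply/seteqP; split=> [_ [eps epsU <-]|_ [k _ <-]].
    by have /z_gen [k ->] := epsU; exists k => //; rewrite iter_unit_mul.
  by exists (z ^+ k); rewrite ?iter_unit_mul //=; apply/z_gen; exists k.
move=> i j ni nj; rewrite !iter_unit_mul => /(congr1 (@^~ 1)).
by rewrite /unit_mul !mulr1 => /(z_inj _ _ ni nj).
Qed.

Lemma stab_isog : comp_isog (stab V) 'D_(2 * unit_order e).
Proof.
have [z [zcj zn z_inj z_gen]] := unit_maps_generator.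
have iterV k : iter k (unit_mul z) = unit_mul (z ^+ k) := iter_unit_mul z k.
(* Conjugation inverts the generator because its norm is 1; this is the dihedral relation. *)
have cjz : cj z = z ^+ (unit_order e).-1.
  have zz : z * z ^+ (unit_order e).-1 = z * cj z.
    by rewrite -exprS prednK ?zn // ltnW // unit_order_gt1.
  by have := congr1 ( *%R (cj z)) zz; rewrite !mulrA [cj z * z]mulrC zcj !mul1r.
apply: (@comp_isog_dihedral _ (unit_mul z) cj _ unit_order_gt1).
- by move=> x; rewrite iterV zn /unit_mul mul1r.
- exact: (qr_conjK qR).
- by move=> x; rewrite iterV -cjz /unit_mul rmorphM.
- apply/seteqP; split=> [A /stabP [eps [sigma [epsU ->]]]|_ [[i j] _ <-]] /=.
    have /z_gen [k ->] := epsU.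
    case: (gal_cases d_lt0 s_sqr s_gen sigma) => ->.
      by exists (k, 0) => //=; rewrite iterV gal_restr1.
    by exists (k, 1%N) => //=; rewrite iterV.
  have cjj : iter j cj = gal_restr (tau ^+ j)%g.
    elim: j => [|j IHj]; first by rewrite gal_restr1.
    by rewrite expgSr gal_restrM -IHj; apply/funext => x.
  apply/stabP; exists (z ^+ i), (tau ^+ j)%g; rewrite iterV cjj; split=> //.
  by apply/z_gen; exists i.
(* Evaluation at 1 recovers the exponent of [z], and evaluation at [sO] then tells conjugation from
   the identity. *)
have iter1 j : iter j cj 1 = 1 by elim: j => //= j ->; rewrite rmorph1.
move=> i j i' j' ni nj ni' nj'; rewrite !iterV => E.
have ii' : i = i'.
  by have := congr1 (@^~ 1) E; rewrite /unit_mul /= !iter1 !mulr1 => /(z_inj _ _ ni ni').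
split=> //; move: E; rewrite ii' => /(congr1 (@^~ sO)); rewrite /unit_mul /=.
have zU : z ^+ i' \is a GRing.unit by apply/z_gen; exists i'.
move=> /(mulrI zU).
by case: j nj => [|[|//]] _; case: j' nj' => [|[|//]] _ //=; rewrite cj_sO => h; case: sO_neqN.
Qed.

End StabiliserGroup.

Theorem theorem3p12 (d : int) (d_lt0 : d < 0) (d_sqf : squarefree_int d)
    (K : splittingFieldType rat) (s : K) (s_sqr : s ^+ 2 = d%:~R)
    (s_gen : <<1; s>>%VS = fullv) :
  let V : set (ringOfIntegers K) := @square_free (ringOfIntegers K) in
  let n : nat := if d == -1 then 4%N else if d == -3 then 6%N else 2%N in
  [/\ forall A : ringOfIntegers K -> ringOfIntegers K, stab V A ->
        exists (eps : ringOfIntegers K) (sigma : gal_of {:K}),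
          [/\ eps \is a GRing.unit, sigma \in ('Gal({:K} / 1))%g
            & A = unit_mul eps \o gal_restr sigma],
      forall (eps : ringOfIntegers K) (sigma : gal_of {:K}),
        eps \is a GRing.unit -> sigma \in ('Gal({:K} / 1))%g ->
        set_bij V V (unit_mul eps \o gal_restr sigma),
      ('Gal({:K} / 1) \isog Zp 2)%g,
      comp_sdprod (@unit_maps K) (@gal_maps K) (stab V) /\
      (forall (eps : ringOfIntegers K) (sigma : gal_of {:K}),
        eps \is a GRing.unit -> sigma \in ('Gal({:K} / 1))%g ->
        gal_restr sigma \o unit_mul eps \o gal_restr (sigma^-1)%g
          = unit_mul (gal_restr sigma eps))
    & [/\ comp_isog (@unit_maps K) 'Z_n, comp_isog (@gal_maps K) 'Z_2
        & comp_isog (stab V) ('D_(2 * n))%type]].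
Proof.
move=> V n.
have nE : n = unit_order `|d|%N.
  have e1 : (`|d|%N == 1%N) = (d == -1) by lia.
  have e3 : (`|d|%N == 3%N) = (d == -3) by lia.
  by rewrite /unit_order e1 e3.
have inG := mem_gal d_lt0 s_sqr s_gen.
split.
- move=> A /(stabP d_lt0 s_sqr s_gen) [eps [sigma [epsU ->]]].
  by exists eps, sigma; split.
- move=> eps sigma epsU _.
  have mapV := square_free_map d_lt0 s_sqr s_gen.
  have fK := unit_gal_cancel sigma epsU; have gK := unit_gal_cancelV sigma epsU.
  split=> [x Vx|x y _ _|x Vx]; [exact: mapV|exact: (can_inj fK)|].
  exists ((unit_mul (gal_restr sigma^-1%g eps^-1) \o gal_restr sigma^-1%g) x).
    by apply: mapV => //; apply: unit_gal_inv_unit.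
  exact: gK.
- exact: (gal_isog d_lt0 s_sqr s_gen).
- split=> [|eps sigma _ _]; first exact: (stab_sdprod d_lt0 s_sqr s_gen).
  apply/funext => x; have := congr1 (@^~ (gal_restr sigma^-1%g x)) (gal_unit_mul sigma eps).
  by move=> /= ->; rewrite gal_restrVK.
rewrite nE; split.
- exact: (unit_maps_isog d_lt0 d_sqf s_sqr s_gen).
- exact: (gal_maps_isog d_lt0 s_sqr s_gen).
exact: (stab_isog d_lt0 d_sqf s_sqr s_gen).
Qed.
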